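(* Let $1\le k_1<k_2<\cdots<k_r\le n$ be integers, write $\mathbf{k}=(k_1,\dots,k_r)$, and let $P_1,\ldots,P_r$ be $n\times n$ symmetric matrices of unknowns. Then the projection flag variety $\mathrm{pFl}(\mathbf{k};n)$ is smooth, and its vanishing ideal is the prime ideal $$\langle P_iP_{i-1}-P_{i-1}\;:\;2\le i\le r\rangle+\langle P_i^2-P_i,\ \operatorname{trace}(P_i)-k_i\;:\;1\le i\le r\rangle\;\subset\;\mathbb{C}[P_1,\ldots,P_r].$$
   Context: The projection flag variety is the affine variety $$\mathrm{pFl}(\mathbf{k};n)=\{(P_1,\ldots,P_r)\in\mathrm{Sym}(\mathbb{C}^n)^r: P_iP_j=P_j,\ \operatorname{trace}(P_i)=k_i\ \text{for } 1\le j\le i\le r\},$$ where $\mathrm{Sym}(\mathbb{C}^n)$ is the space of complex symmetric $n\times n$ matrices. $\mathbb{C}[P_1,\dots,P_r]$ is the polynomial ring in the $r\binom{n+1}{2}$ independent entries of the symmetric matrices $P_1,\dots,P_r$; a matrix listed as an ideal generator stands for all of its entries. *)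

(* Defs.v *)
From HB Require Import structures.
From mathcomp Require Import all_boot all_order all_algebra.
From mathcomp Require Import ring_quotient complex mpoly.
From mathcomp Require Import boolp classical_sets reals.

Set Implicit Arguments.
Unset Strict Implicit.
Unset Printing Implicit Defensive.

Import GRing.Theory.
Local Open Scope classical_set_scope.
Local Open Scope ring_scope.

Section Ideals.
Variable A : comNzRingType.
Implicit Types G I J : set A.

Definition ideal_gen G : set A :=
  [set f | exists s : seq (A * A),
     (forall t, t \in s -> G t.2) /\ f = \sum_(t <- s) t.1 * t.2].

Definition ideal_sum I J : set A := [set f + g | f in I & g in J].

(* idealr_closed already includes 1 \notin I. *)
Definition prime_ideal I : Prop :=
  idealr_closed (mem I) /\ prime_idealr_closed (mem I).

End Ideals.

Section AffineSpace.
Variables (K : fieldType) (N : nat).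
Implicit Types X Y Z : set ('I_N -> K).

Definition zero_locus (G : set {mpoly K[N]}) : set ('I_N -> K) :=
  [set p | forall f, G f -> f.@[p] = 0].

Definition vanishing_ideal X : set {mpoly K[N]} :=
  [set f | forall p, X p -> f.@[p] = 0].

Definition zariski_closed X : Prop := exists G, X = zero_locus G.

Definition irreducible_closed X : Prop :=
  [/\ zariski_closed X, X !=set0 &
      forall Y Z, zariski_closed Y -> zariski_closed Z ->
        X `<=` Y `|` Z -> X `<=` Y \/ X `<=` Z].

Definition chain_through X (p : 'I_N -> K) (d : nat) : Prop :=
  exists Z : nat -> set ('I_N -> K),
    (forall i, (i <= d)%N ->
       [/\ irreducible_closed (Z i), Z i `<=` X & Z i p]) /\
    (forall i, (i < d)%N -> Z i `<` Z i.+1).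

(* dim_p X = d. For closed X, the irreducible closed subsets of X through p
   correspond to the prime ideals of the local ring O_(X,p), so this is the
   Krull dimension of O_(X,p). *)
Definition local_dim X (p : 'I_N -> K) (d : nat) : Prop :=
  chain_through X p d /\ forall e, chain_through X p e -> (e <= d)%N.

(* The Zariski tangent space T_p X, inside K^N. *)
Definition tangent_space X (p : 'I_N -> K) : set 'rV[K]_N :=
  [set v | forall f, vanishing_ideal X f ->
             \sum_(t < N) (f^`M(t)).@[p] * v 0 t = 0].

Definition smooth_at X (p : 'I_N -> K) : Prop :=
  exists T : {vspace 'rV[K]_N},
    (forall v, v \in T <-> tangent_space X p v) /\ local_dim X p (\dim T).

Definition smooth X : Prop := forall p, X p -> smooth_at X p.

End AffineSpace.

(* One coordinate for every i and every position (a, b) with a <= b; the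
   positions (a, b) and (b, a) of a symmetric matrix share a coordinate. *)
Section Coordinates.
Variables r n : nat.

Definition sym_pos := {ab : 'I_n * 'I_n | (ab.1 <= ab.2)%N}.

Definition sort_pos (a b : 'I_n) : 'I_n * 'I_n :=
  if (a <= b)%N then (a, b) else (b, a).

Lemma sort_posP (a b : 'I_n) : ((sort_pos a b).1 <= (sort_pos a b).2)%N.
Proof. by rewrite /sort_pos; case: (leqP a b) => //= /ltnW. Qed.

Definition to_sym_pos (a b : 'I_n) : sym_pos :=
  exist _ (sort_pos a b) (sort_posP a b).

Definition nvars : nat := #|{: 'I_r * sym_pos}|.

Lemma nvarsE : nvars = (r * 'C(n.+1, 2))%N.
Proof.
rewrite /nvars card_prod card_ord; congr muln.
rewrite card_sig -sum1_card.
rewrite (eq_bigl (fun p : 'I_n * 'I_n => true && (p.1 <= p.2)%N)) //.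
rewrite -(pair_big_dep xpredT (fun a b : 'I_n => (a <= b)%N) (fun _ _ => 1%N)).
rewrite (exchange_big_dep xpredT) //=.
rewrite -bin2_sum big_mkord big_ord_recl /= add0n.
apply: eq_bigr => b _; rewrite sum1_card.
pose w := widen_ord (ltn_ord b).
have w_inj : injective w by move=> x y /(congr1 val) /= /val_inj.
rewrite -[RHS]card_ord -(card_imset _ w_inj).
apply: eq_card => a; apply/idP/imsetP => [ab|[c _ ->]].
  by exists (Ordinal (ab : (a < b.+1)%N)) => //; apply: val_inj.
by have := ltn_ord c.
Qed.

Definition var_index (i : 'I_r) (a b : 'I_n) : 'I_nvars :=
  enum_rank (i, to_sym_pos a b).

Definition coords (K : Type) (P : 'I_r -> 'M[K]_n) : 'I_nvars -> K :=
  fun t => let u := enum_val t in P u.1 (sval u.2).1 (sval u.2).2.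

Definition unknown_mx (K : nzRingType) (i : 'I_r) : 'M[{mpoly K[nvars]}]_n :=
  \matrix_(a, b) 'X_(var_index i a b).

Lemma meval_unknown_mx (K : comNzRingType) (P : 'I_r -> 'M[K]_n) i :
  (P i)^T = P i -> map_mx (meval (coords P)) (unknown_mx K i) = P i.
Proof.
move=> symP; apply/matrixP => a b.
rewrite !mxE mevalXU /coords enum_rankK /= /sort_pos.
by case: leqP => //= _; rewrite -[in LHS]symP mxE.
Qed.

End Coordinates.

Section ProjectionFlags.
Variables (K : fieldType) (r n : nat) (k : 'I_r -> nat).

Definition pFl_mx : set ('I_r -> 'M[K]_n) :=
  [set P | (forall i, (P i)^T = P i) /\
           (forall i j : 'I_r, (j <= i)%N ->
              P i *m P j = P j /\ \tr (P i) = (k i)%:R)].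

(* pFl(k; n) as a subset of affine space. *)
Definition pFl : set ('I_(nvars r n) -> K) := @coords r n K @` pFl_mx.

Let P := @unknown_mx r n K.

Definition mx_entries (G : set 'M[{mpoly K[nvars r n]}]_n) :
    set {mpoly K[nvars r n]} :=
  [set f | exists M a b, G M /\ f = M a b].

Definition flag_ideal : set {mpoly K[nvars r n]} :=
  ideal_gen (mx_entries
    [set M | exists i j : 'I_r, i = j.+1 :> nat /\ M = P i *m P j - P j]).

Definition projection_ideal : set {mpoly K[nvars r n]} :=
  ideal_gen
    (mx_entries [set M | exists i : 'I_r, M = P i *m P i - P i] `|`
     [set f | exists i : 'I_r, f = \tr (P i) - (k i)%:R]).

Definition pFl_ideal : set {mpoly K[nvars r n]} :=
  ideal_sum flag_ideal projection_ideal.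

End ProjectionFlags.

Arguments pFl_mx K {r} n k.
Arguments pFl K {r} n k.
Arguments flag_ideal K r n : clear implicits.
Arguments projection_ideal K {r} n k.
Arguments pFl_ideal K {r} n k.

(* Main.v *)
Require Import Defs.
From HB Require Import structures.
From mathcomp Require Import all_boot all_order all_algebra.
From mathcomp Require Import ring_quotient complex mpoly.
From mathcomp Require Import boolp classical_sets reals.
From mathcomp Require Import perm ring.

Set Implicit Arguments.
Unset Strict Implicit.
Unset Printing Implicit Defensive.

Import GRing.Theory.
Local Open Scope classical_set_scope.
Local Open Scope ring_scope.

(** A point of the variety is a flag of symmetric projections P_1, ..., P_r, or
    equivalently the flag of the nondegenerate subspaces im P_i.  Everything
    rests on the formula for an orthogonal projection in terms of a frame: if p
    is a coordinate projection and M a matrix for which the Gram matrix of the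
    columns selected by p is invertible, the orthogonal projection onto the
    span of those columns is M p G^-1 p M^T with G = p M^T M p + (1 - p).
    Fixing a nested family of coordinate projections of ranks k_1, ..., k_r,
    this is a rational map from n x n matrices to the variety (generic_frame),
    and it makes sense over any ring in which the Gram determinants are
    invertible.

    The ideal.  Let A be the quotient of the polynomial ring by the ideal and
    let E_0, ..., E_r be the differences of consecutive stages of the
    tautological flag over A, completed by 1 at the end.  They add up to 1, so
    expanding the determinant of their sum along columns gives
    1 = sum over b of det W_b, where b assigns to each column a block and
    column a of W_b is column a of E_(b a) (sum_det_mixed_frame).  Each W_b
    is a frame adapted to the flag: P_i W_b = W_b p_i.  If b has the wrong block
    sizes, comparing traces gives det W_b = 0; otherwise, once det W_b is
    inverted, the tautological flag is the value of the rational map at W_b.  A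
    polynomial f vanishing on the variety vanishes identically along the
    rational map, hence is killed in A by a power of det W_b.  As the det W_b
    generate the unit ideal, f is 0 in A (vanishing_at_ring_points).

    Primality.  Over the field, some det W_b is nonzero, and after a permutation
    of the columns b may be prescribed; hence the variety is the whole image of
    one rational map defined on an open set of an affine space
    (adapted_frame_exists), and such an image has a prime vanishing ideal
    (ratmap_image_prime).

    Smoothness.  Given an adapted frame M0 at a point, the matrices
    M0 (1 + L) with L strictly lower block triangular give a rational chart
    (flag_chart).  Its inverse is rational too: in the basis M0, the columns of
    1 + L in block i are those of the oblique projection onto the i-th subspace
    along the coordinate subspace of the later blocks (flag_coords).  A variety
    with such charts is smooth (smooth_at_chart).  The tangent space is the
    image of the differential of the chart, as one sees by evaluating
    polynomials at points with values in the dual numbers.  The local dimension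
    is the number d of parameters: coordinate slices of the chart give a chain
    of length d, and a longer chain is impossible because any d + 1 functions
    satisfy a polynomial relation along the chart (algebraically_dependent),
    whereas functions separating the members of a chain satisfy none
    (no_relation_along_chain). *)

(** * Polynomials at points with values in a ring *)

Section RingValuedPoints.

Lemma rmorph_mmap (n : nat) (K B C : comNzRingType) (phi : {rmorphism K -> B})
    (theta : {rmorphism B -> C}) (x : 'I_n -> B) (f : {mpoly K[n]}) :
  theta (mmap phi x f) = mmap (theta \o phi) (theta \o x) f.
Proof.
rewrite /mmap rmorph_sum; apply: eq_bigr => m _; rewrite rmorphM /mmap1.
by rewrite rmorph_prod; congr (_ * _); apply: eq_bigr => i _; rewrite rmorphXn.
Qed.

Lemma mmap_id (n : nat) (K : comNzRingType) (f : {mpoly K[n]}) :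
  mmap (@mpolyC n K) (fun i => 'X_i) f = f.
Proof.
rewrite [RHS]mpolyE /mmap; apply: eq_bigr => m _.
by rewrite mmap1_id mul_mpolyC.
Qed.

Lemma rmorph_mpolyE (n : nat) (K B : comNzRingType)
    (theta : {rmorphism {mpoly K[n]} -> B}) (f : {mpoly K[n]}) :
  theta f = mmap (theta \o @mpolyC n K) (fun i => theta 'X_i) f.
Proof. by rewrite -[f in LHS]mmap_id rmorph_mmap. Qed.

Lemma eq_mmap (n : nat) (K B : comNzRingType) (phi phi' : K -> B)
    (x x' : 'I_n -> B) (f : {mpoly K[n]}) :
  phi =1 phi' -> x =1 x' -> mmap phi x f = mmap phi' x' f.
Proof.
move=> ephi ex; apply: eq_bigr => m _; rewrite ephi; congr (_ * _).
exact: mmap1_eq.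
Qed.

(** The homogenization of f in degree D, evaluated at x with homogenizing
    variable s. It stands for s^D f(x / s) in rings where s need not be
    invertible; D is at least the degree of f in all uses. *)
Definition hmmap (n : nat) (K B : comNzRingType) (D : nat) (phi : K -> B)
    (x : 'I_n -> B) (s : B) (f : {mpoly K[n]}) : B :=
  \sum_(m <- msupp f) phi f@_m * (mmap1 x m * s ^+ (D - mdeg m)).

Lemma rmorph_hmmap (n D : nat) (K B C : comNzRingType) (phi : {rmorphism K -> B})
    (theta : {rmorphism B -> C}) (x : 'I_n -> B) (s : B) (f : {mpoly K[n]}) :
  theta (hmmap D phi x s f) = hmmap D (theta \o phi) (theta \o x) (theta s) f.
Proof.
rewrite /hmmap rmorph_sum; apply: eq_bigr => m _; rewrite !rmorphM /mmap1.
rewrite rmorph_prod rmorphXn; congr (_ * (_ * _)).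
by apply: eq_bigr => i _; rewrite rmorphXn.
Qed.

Lemma eq_hmmap (n D : nat) (K B : comNzRingType) (phi phi' : K -> B)
    (x x' : 'I_n -> B) (s : B) (f : {mpoly K[n]}) :
  phi =1 phi' -> x =1 x' -> hmmap D phi x s f = hmmap D phi' x' s f.
Proof.
move=> ephi ex; apply: eq_bigr => m _; rewrite ephi; congr (_ * (_ * _)).
exact: mmap1_eq.
Qed.

(** The factor c makes the formula usable in rings with zero divisors: there the
    relation x = s y is available only up to multiplication by c, and one factor
    c suffices for all monomials, since c a = c b implies c a^m = c b^m. *)
Lemma hmmapE (n D : nat) (K B : comNzRingType) (phi : K -> B)
    (x y : 'I_n -> B) (s c : B) (f : {mpoly K[n]}) :
  (forall i, c * x i = c * (s * y i)) -> (msize f <= D.+1)%N ->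
  c * hmmap D phi x s f = c * (s ^+ D * mmap phi y f).
Proof.
move=> xy leD; rewrite /hmmap /mmap !mulr_sumr !big_seq.
apply: eq_bigr => m /msize_mdeg_lt m_lt.
have le_mD : (mdeg m <= D)%N by rewrite -ltnS (leq_trans m_lt).
have cX (k : nat) a b : c * a = c * b -> c * a ^+ k = c * b ^+ k.
  move=> cab; elim: k => // k IHk; rewrite !exprS.
  transitivity (a * (c * a ^+ k)); first by ring.
  transitivity (c * a * b ^+ k); first by rewrite IHk; ring.
  by rewrite cab; ring.
have cm : c * mmap1 x m = c * (s ^+ mdeg m * mmap1 y m).
  rewrite /mmap1 mdegE expr_sum -big_split /=.
  apply: (big_rec2 (fun a b => c * a = c * b)) => // i a b _ cab.
  rewrite mulrCA cab mulrCA mulrA (cX _ _ _ (xy i)) exprMn.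
  by rewrite -!mulrA.
rewrite -[in RHS](subnK le_mD) exprD.
transitivity (phi f@_m * (c * mmap1 x m) * s ^+ (D - mdeg m)).
  by ring.
by rewrite cm; move: (phi _) (mmap1 _ _) (s ^+ mdeg m) (s ^+ _) => p q t u; ring.
Qed.

End RingValuedPoints.

(** * Polynomial functions over an infinite field *)

Section PolynomialFunctions.

Variables (K : numFieldType).

Lemma poly_nonroot (q : {poly K}) : q != 0 -> exists t, q.[t] != 0.
Proof.
move=> q0; apply: contrapT => noroot.
pose s := [seq (i%:R : K) | i <- iota 0 (size q)].
have qs : all (root q) s.
  apply/allP => t _; rewrite rootE; apply/negPn/negP => qt.
  by apply: noroot; exists t.
have us : uniq s.
  rewrite map_inj_uniq ?iota_uniq // => i j /eqP.
  by rewrite Num.Theory.eqr_nat => /eqP.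
by have := max_poly_roots q0 qs us; rewrite size_map size_iota ltnn.
Qed.

Definition segment d (u v : 'I_d -> K) (t : K) : 'I_d -> K :=
  fun i => u i + t * (v i - u i).

Lemma segment0 d (u v : 'I_d -> K) : segment u v 0 = u.
Proof. by apply/funext => i; rewrite /segment mul0r addr0. Qed.

Lemma segment1 d (u v : 'I_d -> K) : segment u v 1 = v.
Proof. by apply/funext => i; rewrite /segment; ring. Qed.

Lemma mpoly_on_line d (u v : 'I_d -> K) (f : {mpoly K[d]}) :
  exists q : {poly K}, forall t, q.[t] = f.@[segment u v t].
Proof.
exists (mmap polyC (fun i => (u i)%:P + 'X * (v i - u i)%:P) f) => t.
rewrite -/(horner_eval t _) rmorph_mmap; apply: eq_mmap => x /=.
  by rewrite /horner_eval hornerC.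
by rewrite /horner_eval !hornerE.
Qed.

(** Two nonempty principal open sets meet, and they do so on any line that meets
    both: on that line f and g become nonzero polynomials in one variable.
    Working on a line keeps the argument valid inside linear subspaces. *)
Lemma common_nonzero d (u v : 'I_d -> K) (f g : {mpoly K[d]}) :
  f.@[u] != 0 -> g.@[v] != 0 ->
  exists t, f.@[segment u v t] != 0 /\ g.@[segment u v t] != 0.
Proof.
move=> fu gv; have [[q qE] [q' q'E]] := (mpoly_on_line u v f, mpoly_on_line u v g).
have q0 : q != 0.
  by apply: contraNneq fu => qz; rewrite -(segment0 u v) -qE qz horner0.
have q'0 : q' != 0.
  by apply: contraNneq gv => qz; rewrite -(segment1 u v) -q'E qz horner0.
have [t] := poly_nonroot (mulf_neq0 q0 q'0).
by rewrite hornerM qE q'E mulf_eq0 negb_or => /andP[]; exists t.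
Qed.

(** Evaluating in the last variable after all the others; with B the polynomial
    ring itself this also shows that muni loses no information. *)
Lemma mmap_muni n (B : comNzRingType) (phi : {rmorphism K -> B})
    (x : 'I_n.+1 -> B) (f : {mpoly K[n.+1]}) :
  mmap phi x f =
  (map_poly (mmap phi (fun i : 'I_n => x (widen_ord (leqnSn n) i))) (muni f)).[x ord_max].
Proof.
rewrite muniE raddf_sum /= horner_sum; apply: eq_bigr => m _.
rewrite map_polyZ /= map_polyXn hornerZ hornerXn mmapZ mmapX -mulrA.
rewrite /mmap1 big_ord_recr /=; congr (_ * (_ * _)).
by apply: eq_bigr => i _; rewrite mnmE.
Qed.

Lemma muni_eq0 n (f : {mpoly K[n.+1]}) : (muni f == 0) = (f == 0).
Proof.
apply/eqP/eqP => [f0|->]; last exact: muni0.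
by rewrite -[f]mmap_id mmap_muni f0 map_poly0 horner0.
Qed.

Lemma mpoly_eq0P n (f : {mpoly K[n]}) : (forall v, f.@[v] = 0) -> f = 0.
Proof.
elim: n f => [|n IHn] f f0.
  rewrite [f]nvar0_mpolyC; have := f0 (fun _ => 0).
  by rewrite [f in f.@[_]]nvar0_mpolyC mevalC => ->; rewrite mpolyC0.
apply/eqP; rewrite -muni_eq0; apply/eqP/polyP => k; rewrite coef0.
apply: IHn => v; apply/eqP; rewrite -[_ == 0]negbK; apply/negP => fk0.
pose q := map_poly (meval v) (muni f).
have q0 : q != 0.
  apply: contraNneq fk0 => /polyP/(_ k).
  by rewrite coef_map coef0 /= => ->.
have [t] := poly_nonroot q0; apply/negP/negPn/eqP.
pose w (i : 'I_n.+1) := if unlift ord_max i is Some j then v j else t.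
rewrite -(f0 w) /meval mmap_muni; congr (_.[_]); last first.
  by rewrite /w unlift_none.
apply: eq_map_poly => g; apply: eq_mmap => // i /=.
rewrite /w; have -> : widen_ord (leqnSn n) i = lift ord_max i.
  by apply: val_inj; rewrite /= /bump leqNgt ltn_ord.
by rewrite liftK.
Qed.

End PolynomialFunctions.

(** * Dual numbers *)

Section DualNumbers.

(** The pair (a, b) stands for a + b e with e^2 = 0; the alias separates this
    product from the componentwise product of pairs. *)
Definition dual (K : Type) : Type := (K * K)%type.

Variable K : comNzRingType.

HB.instance Definition _ := GRing.Zmodule.copy (dual K) (K * K)%type.

Definition dual_mul (a b : dual K) : dual K := (a.1 * b.1, a.1 * b.2 + a.2 * b.1).
Definition dual_one : dual K := (1, 0).

Fact dual_mulA : associative dual_mul.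
Proof. by move=> a b c; congr pair; rewrite /=; ring. Qed.

Fact dual_mulC : commutative dual_mul.
Proof. by move=> a b; congr pair; rewrite /=; ring. Qed.

Fact dual_mul1 : left_id dual_one dual_mul.
Proof. by case=> a b; congr pair; rewrite /=; ring. Qed.

Fact dual_mulDl : left_distributive dual_mul +%R.
Proof. by move=> a b c; congr pair; rewrite /=; ring. Qed.

Fact dual_one_neq0 : dual_one != 0.
Proof. by apply/eqP => -[/eqP]; rewrite oner_eq0. Qed.

HB.instance Definition _ := GRing.Zmodule_isComNzRing.Build (dual K)
  dual_mulA dual_mulC dual_mul1 dual_mulDl dual_one_neq0.

Definition dual_const (a : K) : dual K := (a, 0).

Fact dual_const_is_zmod_morphism : zmod_morphism dual_const.
Proof. by move=> a b; congr pair; rewrite /= ?subr0. Qed.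

Fact dual_const_is_monoid_morphism : monoid_morphism dual_const.
Proof. by split=> // a b; congr pair; rewrite /=; ring. Qed.

HB.instance Definition _ := GRing.isZmodMorphism.Build K (dual K) dual_const
  dual_const_is_zmod_morphism.
HB.instance Definition _ := GRing.isMonoidMorphism.Build K (dual K) dual_const
  dual_const_is_monoid_morphism.

Definition tangent_eval n (u w : 'I_n -> K) (f : {mpoly K[n]}) : dual K :=
  (f.@[u], \sum_(i < n) (f^`M(i)).@[u] * w i).

(** Both sides are ring morphisms in f, the right-hand side by the Leibniz rule,
    and they agree on constants and variables. *)
Lemma mmap_dual n (u w : 'I_n -> K) (f : {mpoly K[n]}) :
  mmap dual_const (fun i => (u i, w i) : dual K) f = tangent_eval u w f.
Proof.
have tD g k : tangent_eval u w (g + k) = tangent_eval u w g + tangent_eval u w k.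
  rewrite /tangent_eval mevalD; congr pair; rewrite -big_split /=.
  by apply: eq_bigr => i _; rewrite mderivD mevalD mulrDl.
have tM g k : tangent_eval u w (g * k) = tangent_eval u w g * tangent_eval u w k.
  rewrite /tangent_eval mevalM; congr pair; rewrite /= mulr_sumr mulr_suml -big_split.
  by apply: eq_bigr => i _; rewrite mderivM mevalD !mevalM /=; ring.
have tC c : tangent_eval u w c%:MP = dual_const c.
  rewrite /tangent_eval mevalC; congr pair; apply: big1 => i _.
  by rewrite mderivC meval0 mul0r.
have tX i : tangent_eval u w 'X_i = (u i, w i).
  rewrite /tangent_eval mevalXU; congr pair; rewrite (bigD1 i) //= big1 => [|j ji].
    rewrite mderivX mnmE eqxx scale1r (_ : (U_(i) - U_(i))%MM = 0%MM).
      by rewrite mpolyX0 meval1 mul1r addr0.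
    by apply/mnmP => k; rewrite !mnmE subnn.
  by rewrite mderivX mnmE eq_sym (negPf ji) scale0r meval0 mul0r.
have t1 : tangent_eval u w 1 = 1 by rewrite -mpolyC1 tC.
rewrite -[f in RHS]mmap_id /mmap (big_morph _ tD (_ : _ = 0)); last first.
  by rewrite -mpolyC0 tC; congr pair.
apply: eq_bigr => m _.
have tXm : tangent_eval u w (mmap1 (fun i => 'X_i) m) =
    mmap1 (fun i => (u i, w i) : dual K) m.
  rewrite /mmap1 (big_morph _ tM t1); apply: eq_bigr => i _.
  by elim: (m i) => [|k IHk]; rewrite ?expr0 // !exprS tM tX IHk.
by rewrite tM tC tXm.
Qed.

End DualNumbers.

Lemma dual_expr1 (K : comNzRingType) (a : dual K) m : (a ^+ m).1 = a.1 ^+ m.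
Proof. by elim: m => // m IHm; rewrite !exprS -IHm. Qed.

(** A dual number with nonzero constant term is invertible. *)
Lemma dual_mulI (K : fieldType) (a b c : dual K) : a.1 != 0 -> a * b = a * c -> b = c.
Proof.
move=> a0 [/(mulfI a0) b1 /eqP]; rewrite b1 (inj_eq (addIr _)).
by move=> /eqP/(mulfI a0) b2; rewrite [b]surjective_pairing b1 b2 -surjective_pairing.
Qed.

(** * Rational maps *)

Section RationalMaps.

Variable K : numFieldType.

(** A single denominator is shared by all coordinates, so that composing with a
    polynomial is one homogenization. *)
Record ratmap (d N : nat) := RatMap {
  rnum : 'I_N -> {mpoly K[d]};
  rden : {mpoly K[d]} }.

Definition reval d N (g : ratmap d N) (u : 'I_d -> K) : 'I_N -> K :=
  fun t => (rnum g t).@[u] / (rden g).@[u].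

Lemma revalE d N (g : ratmap d N) u t :
  (rden g).@[u] != 0 -> (rnum g t).@[u] = reval g u t * (rden g).@[u].
Proof. by move=> gu; rewrite /reval divfK. Qed.

(** The numerator of the composite of f with g, over the denominator rden g ^+
    D. *)
Definition pull d N (D : nat) (g : ratmap d N) (f : {mpoly K[N]}) : {mpoly K[d]} :=
  hmmap D (@mpolyC d K) (rnum g) (rden g) f.

(** The composition formula at a point u with values in a ring, where y is the
    value of g at u; again this equality may hold only up to a factor c. *)
Lemma mmap_pull d N D (g : ratmap d N) (B : comNzRingType)
    (phi : {rmorphism K -> B}) (u : 'I_d -> B) (y : 'I_N -> B) (c : B) f :
  (forall t, c * mmap phi u (rnum g t) = c * (mmap phi u (rden g) * y t)) ->
  (msize f <= D.+1)%N ->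
  c * mmap phi u (pull D g f) = c * (mmap phi u (rden g) ^+ D * mmap phi y f).
Proof.
move=> cy leD; rewrite rmorph_hmmap -(hmmapE phi cy leD); congr (_ * _).
by apply: eq_hmmap => // a /=; rewrite mmapC.
Qed.

Lemma meval_pull d N D (g : ratmap d N) u f :
  (rden g).@[u] != 0 -> (msize f <= D.+1)%N ->
  (pull D g f).@[u] = (rden g).@[u] ^+ D * f.@[reval g u].
Proof.
move=> den0 leD; have := @mmap_pull _ _ D g _ idfun u (reval g u) 1 f _ leD.
rewrite !mul1r; apply => t; rewrite !mul1r -!/(meval _ _) /reval.
by rewrite mulrC divfK.
Qed.

(** If f1 is nonzero at the image of u and f2 at the image of v, then by
    common_nonzero both are nonzero at the image of some point of the line
    through u and v. *)
Lemma ratmap_image_prime d N (g : ratmap d N) (L : set ('I_d -> K)) :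
  (forall u v t, L u -> L v -> L (segment u v t)) ->
  forall f1 f2 : {mpoly K[N]},
  (forall u, L u -> (rden g).@[u] != 0 -> (f1 * f2).@[reval g u] = 0) ->
  (forall u, L u -> (rden g).@[u] != 0 -> f1.@[reval g u] = 0) \/
  (forall u, L u -> (rden g).@[u] != 0 -> f2.@[reval g u] = 0).
Proof.
move=> Lseg f1 f2 f120; apply: contrapT => /not_orP[].
move=> /existsNP[u /not_implyP[Lu /not_implyP[gu /eqP f1u]]].
move=> /existsNP[v /not_implyP[Lv /not_implyP[gv /eqP f2v]]].
have pullP f w : (rden g).@[w] != 0 ->
    (rden g * pull (msize f) g f).@[w] != 0 <-> f.@[reval g w] != 0.
  by move=> gw; rewrite mevalM meval_pull // !mulf_eq0 expf_eq0 (negPf gw) andbF.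
have [t [n1 n2]] := common_nonzero ((pullP _ _ gu).2 f1u) ((pullP _ _ gv).2 f2v).
have [g0|gt] := eqVneq (rden g).@[segment u v t] 0.
  by case/eqP: n1; rewrite mevalM g0 mul0r.
have := f120 _ (Lseg _ _ t Lu Lv) gt; apply/eqP; rewrite mevalM.
exact: mulf_neq0 ((pullP _ _ gt).1 n1) ((pullP _ _ gt).1 n2).
Qed.

End RationalMaps.

(** * Irreducible closed sets and prime vanishing ideals *)

Section IrreducibleSets.

Variables (K : fieldType) (N : nat).
Implicit Types (Z S : set ('I_N -> K)).

Lemma irreducible_vanishing_prime Z (f g : {mpoly K[N]}) :
  irreducible_closed Z -> vanishing_ideal Z (f * g) ->
  vanishing_ideal Z f \/ vanishing_ideal Z g.
Proof.
case=> _ _ Zirr fg0.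
pose V (k : {mpoly K[N]}) := zero_locus [set k].
have [||x Zx|Vf|Vg] := Zirr (V f) (V g).
- by exists [set f].
- by exists [set g].
- have /eqP := fg0 _ Zx; rewrite mevalM mulf_eq0.
  by case/orP => /eqP k0; [left|right] => _ ->.
- by left => x /Vf; apply.
- by right => x /Vg; apply.
Qed.

Lemma irreducible_closure S :
  S !=set0 ->
  (forall f g, vanishing_ideal S (f * g) -> vanishing_ideal S f \/ vanishing_ideal S g) ->
  irreducible_closed (zero_locus (vanishing_ideal S)).
Proof.
move=> [s Ss] primeS; split; [by eexists | by exists s => f; apply |].
move=> _ _ [G ->] [H ->] SGH; apply: contrapT => /not_orP[nG nH].
have clos (E : set {mpoly K[N]}) : ~ zero_locus (vanishing_ideal S) `<=` zero_locus E ->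
    exists2 f, E f & ~ vanishing_ideal S f.
  move=> nE; apply: contrapT => noF; apply: nE => x Sx f Ef.
  by apply: Sx; apply: contrapT => nf; apply: noF; exists f.
have [[f Gf nf] [g Hg ng]] := (clos _ nG, clos _ nH).
have [x Sx|/nf|/ng] // := primeS f g.
rewrite mevalM; have [k Sk|k|k] := SGH x; first exact: Sk.
  by rewrite (k _ Gf) mul0r.
by rewrite (k _ Hg) mulr0.
Qed.

End IrreducibleSets.

(** * Algebraic dependence and chains of irreducible closed sets *)

Section AlgebraicDependence.

Lemma msize_mul_le (K : idomainType) n (p q : {mpoly K[n]}) a b :
  (msize p <= a.+1)%N -> (msize q <= b.+1)%N -> (msize (p * q) <= (a + b).+1)%N.
Proof.
have [->|p0 pa] := eqVneq p 0; first by rewrite mul0r msize0.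
have [->|q0 qb] := eqVneq q 0; first by rewrite mulr0 msize0.
rewrite msizeM //; have := leq_add pa qb; rewrite addSn addnS.
by case: (msize p + msize q)%N.
Qed.

Lemma msize_exp_le (K : idomainType) n (p : {mpoly K[n]}) a k :
  (msize p <= a.+1)%N -> (msize (p ^+ k) <= (k * a).+1)%N.
Proof.
move=> pa; elim: k => [|k IHk]; first by rewrite expr0 msize1.
by rewrite exprS mulSn msize_mul_le.
Qed.

Lemma polynomial_beats (d c : nat) : exists2 D, (0 < D)%N &
  ((c * D).+1 ^ d < D ^ d.+1)%N.
Proof.
have [D D_gt0 cD] : exists2 D, (0 < D)%N & (c.+1 ^ d < D)%N by exists (c.+1 ^ d).+1.
exists D => //; apply: (@leq_ltn_trans ((c.+1 * D) ^ d)).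
  have le_cD : ((c * D).+1 <= c.+1 * D)%N by rewrite mulSn -add1n leq_add2r.
  case: d {cD} => [|d]; first by rewrite !expn0.
  by rewrite leq_exp2r.
by rewrite expnMn expnS ltn_pmul2r ?expn_gt0 ?D_gt0.
Qed.

(** In d variables, d + 1 fractions with a common denominator are dependent, by
    counting. There are D^(d+1) monomials with exponents below D in the
    fractions; cleared of denominators, they all lie in a space of polynomials
    of degree O(D), hence of dimension O(D^d). For D large some nontrivial
    combination vanishes. *)
Lemma algebraically_dependent (K : fieldType) d (F : 'I_d.+1 -> {mpoly K[d]})
    (s : {mpoly K[d]}) :
  exists2 Q : {mpoly K[d.+1]}, Q != 0 &
    forall u, s.@[u] != 0 -> Q.@[fun i => (F i).@[u] / s.@[u]] = 0.
Proof.
pose m := maxn (msize s) (\max_i msize (F i)).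
have [D D_gt0 D_big] := polynomial_beats d (d.+1 * m).
pose B := (d.+1 * D)%N.
pose T : finType := {ffun 'I_d.+1 -> 'I_D}.
pose C : finType := {ffun 'I_d -> 'I_(B * m).+1}.
pose mon (a : T) : 'X_{1..d.+1} := [multinom (a i : nat) | i < d.+1].
pose cmon (a : C) : 'X_{1..d} := [multinom (a i : nat) | i < d].
have mdeg_mon a : (mdeg (mon a) <= B)%N.
  rewrite mdegE /B -[d.+1 in leqRHS]card_ord -sum_nat_const; apply: leq_sum => i _.
  by rewrite mnmE ltnW.
pose G a := mmap1 F (mon a) * s ^+ (B - mdeg (mon a)).
have msizeG a : (msize (G a) <= (B * m).+1)%N.
  rewrite -[B in leqRHS](subnKC (mdeg_mon a)) mulnDl; apply: msize_mul_le; last first.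
    by apply: msize_exp_le; rewrite leqW // leq_maxl.
  rewrite /mmap1 mdegE big_distrl /=.
  elim/big_rec2: _ => [|i k p _ IH]; first by rewrite msize1.
  apply: msize_mul_le => //; apply: msize_exp_le.
  by rewrite leqW // leq_max leq_bigmax orbT.
(* Rows: the cleared monomials. Columns: a box of monomials in u that
   contains all those of degree at most B * m. *)
pose A : 'M[K]_(#|T|, #|C|) := \matrix_(a, c) (G (enum_val a))@_(cmon (enum_val c)).
have : kermx A != 0.
  rewrite kermx_eq0 /row_free; apply: contraTneq (rank_leq_col A) => ->.
  by rewrite -ltnNge !card_ffun !card_ord /B mulnAC.
case/rowV0Pn => w /sub_kermxP wA w0.
pose Q : {mpoly K[d.+1]} := \sum_(a : T) w 0 (enum_rank a) *: 'X_[mon a].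
have mon_inj : injective mon.
  move=> a b /mnmP ab; apply/ffunP => i; apply: val_inj.
  by have := ab i; rewrite !mnmE.
have Qcoef a : Q@_(mon a) = w 0 (enum_rank a).
  rewrite raddf_sum (bigD1 a) //= mcoeffZ mcoeffX eqxx mulr1 big1 ?addr0 //.
  by move=> b ba; rewrite mcoeffZ mcoeffX (inj_eq mon_inj) (negPf ba) mulr0.
have G0 : \sum_(a : T) w 0 (enum_rank a) *: G a = 0.
  apply/mpolyP => k; rewrite mcoeff0 raddf_sum /=.
  have [k_big|k_small] := leqP (B * m).+1 (mdeg k).
    apply: big1 => a _; rewrite mcoeffZ memN_msupp_eq0 ?mulr0 //.
    by rewrite msize_mdeg_ge // (leq_trans (msizeG a)).
  have kc i : (k i < (B * m).+1)%N.
    by apply: leq_ltn_trans k_small; rewrite mdegE (bigD1 i) //= leq_addr.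
  pose c : C := [ffun i => Ordinal (kc i)].
  have -> : k = cmon c by apply/mnmP => i; rewrite mnmE ffunE.
  transitivity ((w *m A) 0 (enum_rank c)); last by rewrite wA mxE.
  rewrite mxE.
  rewrite [RHS](reindex (@enum_rank T)) /=; last exact/onW_bij/enum_rank_bij.
  by apply: eq_bigr => a _; rewrite mcoeffZ mxE !enum_rankK.
exists Q.
  apply: contraNneq w0 => Q0; apply/eqP/rowP => j.
  by rewrite mxE -[j]enum_valK -Qcoef Q0 mcoeff0.
move=> u su; apply: (mulfI (expf_neq0 B su)); rewrite mulr0.
transitivity (meval u (\sum_(a : T) w 0 (enum_rank a) *: G a)); last first.
  by rewrite G0 meval0.
rewrite !raddf_sum mulr_sumr /=; apply: eq_bigr => a _.
rewrite !mevalZ mevalX mulrCA; congr (_ * _); rewrite mevalM rmorphXn /=.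
rewrite -{1}(subnK (mdeg_mon a)) exprD -mulrA mulrC; congr (_ * _).
rewrite mdegE expr_sum -big_split /mmap1 rmorph_prod /=; apply: eq_bigr => i _.
by rewrite rmorphXn -exprMn mulrC divfK.
Qed.

End AlgebraicDependence.

Section Chains.

Variables (K : numFieldType) (N : nat).

(** Elimination of the last variable. As f_(l-1) does not vanish on the
    irreducible Z_l, the largest power of the last variable dividing Q may be
    cancelled in a relation on Z_l; on Z_(l-1), where f_(l-1) = 0, what remains
    is a nonzero polynomial in the previous functions, and one concludes by
    induction. *)
Lemma no_relation_along_chain l (Q : {mpoly K[l]}) (f : nat -> {mpoly K[N]})
    (Z : nat -> set ('I_N -> K)) :
  Q != 0 ->
  (forall i, (i <= l)%N -> irreducible_closed (Z i)) ->
  (forall i, (i < l)%N -> Z i `<=` Z i.+1) ->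
  (forall i, (i < l)%N -> vanishing_ideal (Z i) (f i)) ->
  (forall i, (i < l)%N -> ~ vanishing_ideal (Z i.+1) (f i)) ->
  ~ vanishing_ideal (Z l) (mmap (@mpolyC N K) (fun i : 'I_l => f i) Q).
Proof.
elim: l Q => [|l IHl] Q Q0 Zirr Zsub fZ fnZ QZ.
  have [_ [x Zx] _] := Zirr 0 (leqnn 0).
  have := QZ _ Zx; rewrite {1}[Q]nvar0_mpolyC mmapC mevalC => Qc.
  by case/eqP: Q0; rewrite [Q]nvar0_mpolyC Qc mpolyC0.
have exk : exists k, (muni Q)`_k != 0.
  by exists (size (muni Q)).-1; rewrite -lead_coefE lead_coef_eq0 muni_eq0.
case: (ex_minnP exk) => k qk kmin.
pose q := drop_poly k (muni Q).
have qE : muni Q = q * 'X^k.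
  rewrite -[LHS](poly_take_drop k) (_ : take_poly k _ = 0) ?add0r //.
  apply/polyP => j; rewrite coef_take_poly coef0; case: ltnP => // jk.
  by apply/eqP; apply: contraTT jk => /kmin; rewrite -leqNgt.
pose psi := mmap (@mpolyC N K) (fun i : 'I_l => f i).
pose F := (map_poly psi q).[f l].
have QE : mmap (@mpolyC N K) (fun i : 'I_l.+1 => f i) Q = F * f l ^+ k.
  rewrite mmap_muni qE rmorphM /= map_polyXn hornerM hornerXn /F.
  by congr (_.[_] * _); apply: eq_map_poly => g; apply: eq_mmap.
have ZF : vanishing_ideal (Z l.+1) F.
  have irr := Zirr l.+1 (leqnn _).
  move: QZ; rewrite QE; clearbody F; elim: (k) => [|j IHj]; first by rewrite mulr1.
  rewrite exprSr mulrA => /(irreducible_vanishing_prime irr)[/IHj//|].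
  by move/fnZ; case.
apply: (IHl q`_0).
- by rewrite coef_drop_poly.
- by move=> i il; apply/Zirr/leqW.
- by move=> i il; apply/Zsub/leqW.
- by move=> i il; apply/fZ/leqW.
- by move=> i il; apply/fnZ/leqW.
move=> x Zx; have := ZF _ (Zsub l (leqnn _) _ Zx).
rewrite /F -horner_map /= (fZ l (leqnn _) _ Zx) horner_coef0.
by rewrite !coef_map.
Qed.

End Chains.

(** * Smoothness from a rational chart *)

Section Charts.

Variables (K : numFieldType) (d N : nat) (X : set ('I_N -> K)).
Variables (g : ratmap K d N) (h : ratmap K N d) (u0 : 'I_d -> K) (p : 'I_N -> K).
Hypothesis Xclosed : zariski_closed X.
Hypothesis gX : forall u, (rden g).@[u] != 0 -> X (reval g u).
Hypothesis gu0 : (rden g).@[u0] != 0.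
Hypothesis gp : reval g u0 = p.
Hypothesis hp : (rden h).@[p] != 0.
Hypothesis ghK : forall x, X x -> (rden h).@[x] != 0 ->
  (rden g).@[reval h x] != 0 /\ reval g (reval h x) = x.
Hypothesis hgK : forall u, (rden g).@[u] != 0 -> (rden h).@[reval g u] != 0 ->
  reval h (reval g u) = u.

Let Xp : X p. Proof. by rewrite -gp; apply: gX. Qed.

Let flat (j : nat) : set ('I_d -> K) :=
  [set u | forall i : 'I_d, (j <= i)%N -> u i = u0 i].

Let slice (j : nat) : set ('I_N -> K) :=
  [set reval g u | u in flat j `&` [set u | (rden g).@[u] != 0]].

Lemma flat_segment j u v t : flat j u -> flat j v -> flat j (segment u v t).
Proof. by move=> fu fv i ji; rewrite /segment fu // fv // subrr mulr0 addr0. Qed.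

Lemma slice_irreducible j : irreducible_closed (zero_locus (vanishing_ideal (slice j))).
Proof.
apply: irreducible_closure; first by exists p, u0.
move=> f1 f2 f12.
have [u Lu gu|f0|f0] := ratmap_image_prime (@flat_segment j) (f1 := f1) (f2 := f2) (g := g).
- by apply: f12; exists u.
- by left => _ [u [Lu gu] <-]; apply: f0.
- by right => _ [u [Lu gu] <-]; apply: f0.
Qed.

(** The closures of the images of the coordinate subspaces through u0 form the
    chain. Each is irreducible by slice_irreducible, and the j-th coordinate
    function of the inverse chart tells two consecutive ones apart. *)
Lemma chart_chain : chain_through X p d.
Proof.
exists (fun j => zero_locus (vanishing_ideal (slice j))); split => j j_le.
  split; first exact: slice_irreducible.
    have [G XG] := Xclosed; rewrite XG => x Zx f Gf; apply: Zx => _ [u [_ gu] <-].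
    by have := gX gu; rewrite XG; apply.
  by move=> f; apply; exists u0.
split.
  move=> x Zx f fZ; apply: Zx => _ [u [Lu gu] <-]; apply: fZ; exists u => //.
  by split=> // i /ltnW; apply: Lu.
pose o := Ordinal j_le.
(* The j-th chart coordinate minus its value at u0, cleared of denominators;
   the extra factor rden h makes it vanish also where h is undefined. *)
pose f := rden h * (rnum h o - (u0 o)%:MP * rden h).
pose v i := u0 i + (i == o)%:R.
have [||t []] := @common_nonzero K d u0 v
  (rden g * pull (msize (rden h)) g (rden h)) ('X_o - (u0 o)%:MP).
- by rewrite mevalM meval_pull // gp !mulf_neq0 // expf_neq0.
- by rewrite mevalB mevalXU mevalC /v eqxx addrC addKr oner_neq0.
set w := segment u0 v t => ghw wo sub.
have gw : (rden g).@[w] != 0 by apply: contraNneq ghw; rewrite mevalM => ->; rewrite mul0r.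
have hw : (rden h).@[reval g w] != 0.
  by apply: contraNneq ghw => hw; rewrite mevalM meval_pull // hw !mulr0.
have Sw : slice j.+1 (reval g w).
  exists w => //; split=> // i ji; rewrite /w /segment /v.
  have -> : i == o = false by apply/eqP => io; rewrite io ltnn in ji.
  by rewrite addr0 subrr mulr0 addr0.
have fval u : (rden g).@[u] != 0 -> (rden h).@[reval g u] != 0 ->
    f.@[reval g u] = (rden h).@[reval g u] ^+ 2 * (u o - u0 o).
  move=> gu hu; rewrite mevalM mevalB mevalM mevalC.
  have -> : (rnum h o).@[reval g u] = u o * (rden h).@[reval g u].
    by rewrite revalE // hgK.
  by ring.
have fj : vanishing_ideal (slice j) f.
  move=> _ [u [Lu gu] <-]; have [hu|hu] := eqVneq (rden h).@[reval g u] 0.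
    by rewrite mevalM hu mul0r.
  by rewrite fval // Lu // subrr mulr0.
have /sub/(_ _ fj)/eqP : zero_locus (vanishing_ideal (slice j.+1)) (reval g w).
  by move=> k; apply.
rewrite fval //; apply/negP; rewrite mulf_neq0 ?expf_neq0 //.
by move: wo; rewrite mevalB mevalXU mevalC.
Qed.

(** Functions separating the members of a chain of length d + 1 would pull back
    to d + 1 fractions in d variables, which satisfy a relation; the relation
    holds on all of X away from rden h = 0, hence on the largest member of the
    chain, which contains p. *)
Lemma chart_chain_max e : chain_through X p e -> (e <= d)%N.
Proof.
case=> Z [Zirr Zlt]; rewrite leqNgt; apply/negP => lt_de.
have f_ex i : exists f : {mpoly K[N]}, (i < d.+1)%N ->
    vanishing_ideal (Z i) f /\ ~ vanishing_ideal (Z i.+1) f.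
  have [lt_id|] := boolP (i < d.+1)%N; last by exists 0.
  have lt_ie : (i < e)%N := leq_trans lt_id lt_de.
  have [_ nsub] := Zlt i lt_ie; have [[[G ZG] _ _] _ _] := Zirr i (ltnW lt_ie).
  apply: contrapT => nof; apply: nsub => x Zx; rewrite ZG => f Gf.
  apply: contrapT => fx; apply: nof; exists f => _; split; last by move=> /(_ _ Zx).
  by move=> y; rewrite ZG; apply.
have [f /(_ _)fP] := choice f_ex.
pose D := \max_(i < d.+1) msize (f i).
have leD (i : 'I_d.+1) : (msize (f i) <= D.+1)%N.
  by rewrite leqW // (leq_bigmax (F := fun i : 'I_d.+1 => msize (f i))).
have [Q Q0 Qf] := algebraically_dependent
  (fun i : 'I_d.+1 => pull D g (f i)) (rden g ^+ D).
apply: (@no_relation_along_chain K N d.+1 Q f Z Q0).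
- by move=> i le_id; have [] := Zirr i (leq_trans le_id lt_de).
- by move=> i lt_id; have [] := Zlt i (leq_trans lt_id lt_de).
- by move=> i lt_id; have [] := fP i lt_id.
- by move=> i lt_id; have [] := fP i lt_id.
have [Zirr' ZX Zp] := Zirr d.+1 lt_de.
(* The relation holds on X only where rden h is nonzero, so it is multiplied
   by rden h; irreducibility of the top member, on which rden h does not
   vanish, removes this factor. *)
have [|hZ|//] := irreducible_vanishing_prime (f := rden h)
  (g := mmap (@mpolyC N K) (fun i : 'I_d.+1 => f i) Q) Zirr'; last first.
  by case/eqP: hp; apply: hZ.
move=> x /ZX Xx; rewrite mevalM.
have [->|hx] := eqVneq (rden h).@[x] 0; first by rewrite mul0r.
have [gx xE] := ghK Xx hx; apply/eqP; rewrite mulf_eq0 (negPf hx) /=; apply/eqP.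
have gD : (rden g ^+ D).@[reval h x] != 0 by rewrite rmorphXn expf_neq0.
rewrite -[RHS](Qf _ gD) rmorph_mmap /meval; apply: eq_mmap => [a|i] /=.
  by rewrite ?mmapC ?mevalC.
by rewrite -!/(meval _ _) meval_pull // xE rmorphXn mulrC mulKf // expf_neq0.
Qed.

Let jacobian : 'M[K]_(d, N) := \matrix_(i, t)
  ((((rnum g t)^`M(i)).@[u0] - p t * ((rden g)^`M(i)).@[u0]) / (rden g).@[u0]).

Let lift_param (w : 'rV[K]_d) : 'I_d -> dual K := fun i => (u0 i, w 0 i).
Let lift_point (v : 'rV[K]_N) : 'I_N -> dual K := fun t => (p t, v 0 t).

Let rnum_u0 t : (rnum g t).@[u0] = p t * (rden g).@[u0].
Proof. by rewrite revalE // gp. Qed.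

(** The dual-number point (p, v) is the value of the chart at (u0, w) exactly
    when v is the image of w under the differential of the chart at u0; this is
    the quotient rule. *)
Lemma jacobian_dual (w : 'rV[K]_d) (v : 'rV[K]_N) :
  v = w *m jacobian <-> forall t, mmap (@dual_const K) (lift_param w) (rnum g t) =
    mmap (@dual_const K) (lift_param w) (rden g) * lift_point v t.
Proof.
have vE t : (w *m jacobian) 0 t =
    (\sum_(i < d) ((rnum g t)^`M(i)).@[u0] * w 0 i -
     p t * \sum_(i < d) ((rden g)^`M(i)).@[u0] * w 0 i) / (rden g).@[u0].
  rewrite mxE mulr_sumr -sumrB mulr_suml; apply: eq_bigr => i _.
  by rewrite mxE; ring.
split=> [-> t|E].
  rewrite !mmap_dual /tangent_eval /lift_point rnum_u0 vE.
  by congr pair => /=; field.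
apply/rowP => t; have := E t; rewrite vE !mmap_dual /tangent_eval /lift_point.
by case=> _ ->; rewrite /=; field.
Qed.

(** Tangent vectors at p are the points of X with values in the dual numbers
    that reduce to p. *)
Lemma dual_point_tangent (v : 'rV[K]_N) :
  tangent_space X p v <->
  forall f, vanishing_ideal X f -> mmap (@dual_const K) (lift_point v) f = 0.
Proof.
split=> tv f fX; have := tv f fX; rewrite mmap_dual /tangent_eval; last by case.
by move=> ->; rewrite fX.
Qed.

(** A polynomial vanishing on X vanishes identically along the chart, so also at
    dual-number values of the chart. *)
Lemma jacobian_tangent (w : 'rV[K]_d) : tangent_space X p (w *m jacobian).
Proof.
apply/dual_point_tangent => f fX.
have /jacobian_dual E : w *m jacobian = w *m jacobian by [].
have F0 : rden g * pull (msize f) g f = 0.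
  apply: mpoly_eq0P => u; rewrite mevalM.
  have [->|gu] := eqVneq (rden g).@[u] 0; first by rewrite mul0r.
  by rewrite meval_pull // fX ?mulr0 //; apply: gX.
have := @mmap_pull K d N (msize f) g _ (@dual_const K) (lift_param w)
  (lift_point (w *m jacobian)) (mmap (@dual_const K) (lift_param w) (rden g)) f _ (leqnSn _).
rewrite -rmorphM F0 rmorph0 mulrA -exprS => E0.
apply: (@dual_mulI _ (mmap (@dual_const K) (lift_param w) (rden g) ^+ (msize f).+1)).
  by rewrite dual_expr1 mmap_dual expf_neq0.
by rewrite mulr0 -E0 // => t; rewrite E.
Qed.

(** The identity g o h = id on X, cleared of denominators, is a polynomial
    vanishing on X. It therefore holds at the dual-number point given by a
    tangent vector, which exhibits this point as a value of the chart. *)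
Lemma tangent_jacobian (v : 'rV[K]_N) :
  tangent_space X p v -> exists w : 'rV[K]_d, v = w *m jacobian.
Proof.
move=> /dual_point_tangent tv.
pose pv (f : {mpoly K[N]}) := mmap (@dual_const K) (lift_point v) f.
have pvE f : pv f = tangent_eval p (v 0) f by exact: mmap_dual.
have hpv : (pv (rden h)).1 != 0 by rewrite pvE.
have hnum i : (rnum h i).@[p] = u0 i * (rden h).@[p].
  by rewrite revalE // -gp hgK // gp.
pose w : 'rV[K]_d := \row_i
  (((pv (rnum h i)).2 - u0 i * (pv (rden h)).2) / (rden h).@[p]).
exists w; apply/jacobian_dual => t.
have [D numD denD] : exists2 D, (msize (rnum g t) <= D.+1)%N & (msize (rden g) <= D.+1)%N.
  by exists (maxn (msize (rnum g t)) (msize (rden g))); rewrite leqW ?leq_maxl ?leq_maxr.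
have R0 : vanishing_ideal X
    (rden h * (pull D h (rnum g t) - 'X_t * pull D h (rden g))).
  move=> x Xx; rewrite mevalM mevalB mevalM mevalXU.
  have [->|hx] := eqVneq (rden h).@[x] 0; first by rewrite mul0r.
  have [gx xE] := ghK Xx hx; rewrite !meval_pull //.
  have -> : (rnum g t).@[reval h x] = x t * (rden g).@[reval h x].
    by rewrite revalE // xE.
  by ring.
have hE i : 1 * pv (rnum h i) = 1 * (pv (rden h) * lift_param w i).
  rewrite !mul1r !pvE /tangent_eval /lift_param; congr pair; rewrite /= ?hnum ?mxE.
    by rewrite mulrC.
  by rewrite !pvE /=; field.
have := tv _ R0; rewrite rmorphM rmorphB rmorphM /= mmapX mmap1U.
have pullE f : (msize f <= D.+1)%N -> mmap (@dual_const K) (lift_point v) (pull D h f)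
    = pv (rden h) ^+ D * mmap (@dual_const K) (lift_param w) f.
  by move=> fD; have := mmap_pull hE fD; rewrite !mul1r.
rewrite !pullE // => E.
apply: (@dual_mulI _ (pv (rden h) ^+ D.+1)); first by rewrite dual_expr1 expf_neq0.
apply/eqP; rewrite -subr_eq0 -E exprS /pv; apply/eqP.
move: (mmap _ _ (rden h)) (mmap _ _ (rden g)) (mmap _ _ (rnum g t)) (lift_point v t).
by move=> a b c y; rewrite -!mulrA -mulrBr; congr (_ * _); ring.
Qed.

(** The identity h o g = id is a polynomial identity in u once cleared of
    denominators, so it can be evaluated at dual numbers: a parameter vector w
    whose image is 0 must vanish. *)
Lemma jacobian_free : row_free jacobian.
Proof.
rewrite -kermx_eq0; apply/eqP/row_matrixP => k; rewrite row0.
set w := row k _; have /sub_kermxP/esym/jacobian_dual E : (w <= kermx jacobian)%MS.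
  exact: row_sub.
apply/rowP => i; rewrite [RHS]mxE.
have [D numD denD] : exists2 D, (msize (rnum h i) <= D.+1)%N & (msize (rden h) <= D.+1)%N.
  by exists (maxn (msize (rnum h i)) (msize (rden h))); rewrite leqW ?leq_maxl ?leq_maxr.
have R0 : rden g * pull D g (rden h) * (pull D g (rnum h i) - 'X_i * pull D g (rden h)) = 0.
  apply: mpoly_eq0P => u; rewrite !mevalM mevalB mevalM mevalXU.
  have [->|gu] := eqVneq (rden g).@[u] 0; first by rewrite !mul0r.
  rewrite !meval_pull //.
  have [->|hu] := eqVneq (rden h).@[reval g u] 0; first by rewrite !(mulr0, mul0r).
  have -> : (rnum h i).@[reval g u] = u i * (rden h).@[reval g u].
    by rewrite revalE // hgK.
  by ring.
pose pu f := mmap (@dual_const K) (lift_param w) f.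
pose pv f := mmap (@dual_const K) (lift_point 0) f.
have pullE f : (msize f <= D.+1)%N -> pu (pull D g f) = pu (rden g) ^+ D * pv f.
  move=> fD; have := @mmap_pull K d N D g _ (@dual_const K) (lift_param w) (lift_point 0) 1 f _ fD.
  by rewrite !mul1r; apply => t; rewrite !mul1r E.
have := congr1 pu R0; rewrite /pu rmorph0 !rmorphM rmorphB rmorphM /= mmapX mmap1U -!/(pu _).
rewrite !pullE // => E0.
have : pv (rnum h i) = lift_param w i * pv (rden h).
  apply: (@dual_mulI _ (pu (rden g) * (pu (rden g) ^+ D * pv (rden h)) * pu (rden g) ^+ D)).
    by rewrite /= !dual_expr1 /pu /pv !mmap_dual /= !mulf_neq0 ?expf_neq0.
  apply/eqP; rewrite -subr_eq0 -E0; apply/eqP.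
  move: (pu _) (pv (rden h)) (pv (rnum h i)) (lift_param w i) => a b c y; ring.
rewrite /pv !mmap_dual /tangent_eval /lift_param => -[_].
have s0 (f : {mpoly K[N]}) : \sum_(t < N) (f^`M(t)).@[p] * (0 : 'rV[K]_N) 0 t = 0.
  by apply: big1 => t _; rewrite mxE mulr0.
rewrite !s0 mulr0 add0r => /esym/eqP.
by rewrite mulf_eq0 (negPf hp) orbF => /eqP.
Qed.

Theorem smooth_at_chart : smooth_at X p.
Proof.
pose phi : 'Hom('rV[K]_d, 'rV[K]_N) := linfun (mulmxr jacobian).
have phi_inj : lker phi == 0%VS.
  apply/lker0P => w1 w2; rewrite !lfunE /=.
  by move/(row_free_inj jacobian_free).
exists (limg phi); split.
  move=> v; split=> [/memv_imgP[w _ ->]|/tangent_jacobian[w ->]].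
    by rewrite lfunE; apply: jacobian_tangent.
  have <- : phi w = w *m jacobian by rewrite lfunE.
  by rewrite memv_img ?memvf.
rewrite limg_dim_eq; last by rewrite (eqP phi_inj) capv0.
rewrite dimvf /dim /= mul1n; split; [exact: chart_chain | exact: chart_chain_max].
Qed.

End Charts.

(** * Orthogonal projections from frames *)

Section Frames.

Variables (B : comNzRingType) (n : nat) (p : 'M[B]_n).
Hypotheses (psym : p^T = p) (pidem : p *m p = p).
Implicit Types M P : 'M[B]_n.

(** The summand 1 - p completes the Gram matrix of the columns of M selected by
    p to an n x n matrix with the same determinant. *)
Definition gram M := p *m M^T *m M *m p + (1%:M - p).
Definition gden M := \det (gram M).

(** Up to the factor gden, the orthogonal projection onto the span of the
    columns of M selected by p. *)
Definition gnum M := M *m p *m \adj (gram M) *m p *m M^T.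

Lemma proj_compl : (1%:M - p) *m p = 0.
Proof. by rewrite mulmxBl mul1mx pidem subrr. Qed.

Lemma gram_compl M : gram M *m (1%:M - p) = 1%:M - p.
Proof.
rewrite /gram mulmxDl -mulmxA mulmxBr mulmx1 pidem subrr mulmx0 add0r.
by rewrite mulmxBr mulmx1 proj_compl subr0.
Qed.

Lemma gram_proj M : gram M *m p = p *m M^T *m M *m p.
Proof. by rewrite /gram mulmxDl proj_compl addr0 -!mulmxA pidem. Qed.

Lemma gram_sym M : (gram M)^T = gram M.
Proof.
rewrite /gram linearD linearB /= trmx1 psym !trmx_mul psym trmxK.
by rewrite !mulmxA.
Qed.

Lemma gnum_sym M : (gnum M)^T = gnum M.
Proof.
by rewrite /gnum !trmx_mul trmxK psym trmx_adj gram_sym !mulmxA.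
Qed.

Lemma gnum_fix M : gnum M *m M *m p = gden M *: (M *m p).
Proof.
rewrite /gnum -!mulmxA (mulmxA p M^T) (mulmxA _ M p) -gram_proj.
by rewrite (mulmxA (\adj _)) mul_adj_mx mul_scalar_mx -!scalemxAr pidem.
Qed.

Lemma mxtrace_gnum M : \tr (gnum M) = gden M * \tr p.
Proof.
have adj_compl : \adj (gram M) *m (1%:M - p) = gden M *: (1%:M - p).
  by rewrite -[in LHS](gram_compl M) mulmxA mul_adj_mx mul_scalar_mx.
rewrite /gnum -!mulmxA mxtrace_mulC -!mulmxA mxtrace_mulC -!mulmxA.
rewrite (_ : _ *m _ = \adj (gram M) *m (gram M - (1%:M - p))); last first.
  by rewrite /gram addrK !mulmxA.
rewrite mulmxBr mul_adj_mx adj_compl linearB linearZ /= linearB /=.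
by rewrite mxtrace_scalar mxtrace1 mulrBr mulr_natr opprB addrC subrK.
Qed.

(** Here M' plays the part of c M^-1. The hypotheses say that P fixes the image
    of M p and, up to c, has its own image inside it; being symmetric, P is then
    the orthogonal projection onto that image. *)
Lemma gnum_adapted M M' P c :
  M *m M' = c%:M -> P^T = P -> P *m M *m p = M *m p -> p *m M' *m P = M' *m P ->
  c *: gnum M = (c * gden M) *: P.
Proof.
move=> MM' symP PM M'P; have PM' : p *m M^T *m P = p *m M^T.
  by have := congr1 trmx PM; rewrite !trmx_mul psym symP mulmxA.
have numP : gnum M *m P = gnum M by rewrite /gnum -!mulmxA (mulmxA p M^T P) PM'.
have cP : c *: P = M *m p *m M' *m P.
  by rewrite -!mulmxA (mulmxA p M' P) M'P mulmxA MM' mul_scalar_mx.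
have -> : c *: gnum M = gnum M *m M *m p *m (M' *m P).
  by rewrite -{1}numP scalemxAr cP !mulmxA.
rewrite gnum_fix -scalemxAl mulrC -scalerA; congr (_ *: _).
by rewrite cP !mulmxA.
Qed.

(** The inverse of the Gram matrix is p M^-1 P M^-T p + (1 - p), written with
    denominators cleared. *)
Lemma gden_adapted M M' P c :
  M *m M' = c%:M -> M' *m M = c%:M -> P^T = P ->
  P *m M *m p = M *m p -> p *m M' *m P = M' *m P ->
  exists z, gden M * z = (c ^+ 2) ^+ n.
Proof.
move=> MM' M'M symP PM M'P; have PM' : p *m M^T *m P = p *m M^T.
  by have := congr1 trmx PM; rewrite !trmx_mul psym symP mulmxA.
pose G := p *m M' *m P *m M'^T *m p + c ^+ 2 *: (1%:M - p).
exists (\det G); rewrite /gden -det_mulmx -det_scalar; congr (\det _).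
rewrite mulmxDr -scalemxAr gram_compl !mulmxA gram_proj.
have -> : p *m M^T *m M *m p *m M' *m P *m M'^T *m p = c ^+ 2 *: p.
  rewrite -(mulmxA _ p M') -(mulmxA _ _ P) M'P !mulmxA.
  rewrite -(mulmxA _ M M') MM' mul_mx_scalar -!scalemxAl PM'.
  rewrite -(mulmxA _ M^T) -trmx_mul M'M tr_scalar_mx mul_mx_scalar -scalemxAl.
  by rewrite scalerA pidem expr2.
by rewrite -scalerDr addrC subrK scalemx1.
Qed.

End Frames.

Section FrameMorphism.

Variables (B C : comNzRingType) (theta : {rmorphism B -> C}) (n : nat).

Lemma map_gram (p M : 'M[B]_n) :
  map_mx theta (gram p M) = gram (map_mx theta p) (map_mx theta M).
Proof. by rewrite /gram map_mxD map_mxB !map_mxM map_mx1 map_trmx. Qed.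

Lemma map_gden (p M : 'M[B]_n) :
  theta (gden p M) = gden (map_mx theta p) (map_mx theta M).
Proof. by rewrite /gden -det_map_mx map_gram. Qed.

Lemma map_gnum (p M : 'M[B]_n) :
  map_mx theta (gnum p M) = gnum (map_mx theta p) (map_mx theta M).
Proof. by rewrite /gnum !map_mxM map_mx_adj map_gram map_trmx. Qed.

End FrameMorphism.

(** * Idempotent matrices in characteristic zero *)

Section Idempotents.

Variables (K : numFieldType) (n : nat).
Implicit Types T Y p S : 'M[K]_n.

(** The trace of an idempotent is its rank, by a full-rank factorization. *)
Lemma idempotent_trace0 T : T *m T = T -> \tr T = 0 -> T = 0.
Proof.
move=> TT trT; have CR : row_base T *m col_base T = 1%:M.
  apply: (row_full_inj (col_base_full T)); apply: (row_free_inj (row_base_free T)).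
  by rewrite mulmx1 mulmxA mulmx_base -mulmxA mulmx_base TT.
apply/eqP; rewrite -mxrank_eq0; have := trT.
rewrite -{1}(mulmx_base T) mxtrace_mulC CR mxtrace1 => /eqP.
by rewrite Num.Theory.pnatr_eq0.
Qed.

(** If im T is contained in im Y and the traces agree, the images agree: Y - T Y
    is an idempotent of trace 0. *)
Lemma idempotent_absorb T Y :
  T *m T = T -> Y *m Y = Y -> Y *m T = T -> \tr Y = \tr T -> T *m Y = Y.
Proof.
move=> TT YY YT trYT; apply/esym/eqP; rewrite -subr_eq0; apply/eqP.
apply: idempotent_trace0.
  have YD : Y *m (Y - T *m Y) = Y - T *m Y by rewrite mulmxBr YY mulmxA YT.
  have TD : T *m (Y - T *m Y) = 0 by rewrite mulmxBr mulmxA TT subrr.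
  by rewrite mulmxBl -mulmxA YD TD subr0.
by rewrite linearB /= mxtrace_mulC YT trYT subrr.
Qed.

(** The projection onto the image of Y along the kernel of p, for p and Y of
    equal rank and in general position. *)
Definition oblique p Y := Y *m p *m invmx (p *m Y *m p + (1%:M - p)).

Variables (p Y : 'M[K]_n).
Hypotheses (pidem : p *m p = p) (Yidem : Y *m Y = Y).
Hypothesis Hunit : p *m Y *m p + (1%:M - p) \in unitmx.
Let H := p *m Y *m p + (1%:M - p).

Lemma oblique_comm : invmx H *m p = p *m invmx H.
Proof.
apply: (row_full_inj (A := H)); first by rewrite row_full_unit.
rewrite mulmxA mulmxV // mul1mx mulmxA.
have Hp : H *m p = p *m H.
  rewrite /H mulmxDl mulmxDr (proj_compl pidem) mulmxBr mulmx1 pidem subrr.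
  by rewrite !mulmxA pidem -mulmxA pidem.
by rewrite Hp -mulmxA mulmxV // mulmx1.
Qed.

Lemma oblique_projr : oblique p Y *m p = oblique p Y.
Proof. by rewrite /oblique -/H -mulmxA oblique_comm mulmxA -(mulmxA Y) pidem. Qed.

Lemma oblique_projl : p *m oblique p Y = p.
Proof.
have compl : (1%:M - p) *m invmx H = 1%:M - p.
  have compH : (1%:M - p) *m H = 1%:M - p.
    rewrite /H mulmxDr !mulmxA (proj_compl pidem) !mul0mx add0r.
    by rewrite mulmxBr mulmx1 (proj_compl pidem) subr0.
  by rewrite -{1}compH -mulmxA mulmxV // mulmx1.
rewrite /oblique -/H !mulmxA (_ : p *m Y *m p = H - (1%:M - p)); last by rewrite /H addrK.
by rewrite mulmxBl mulmxV // compl opprB addrC subrK.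
Qed.

Lemma oblique_idem : oblique p Y *m oblique p Y = oblique p Y.
Proof. by rewrite -{1}oblique_projr -mulmxA oblique_projl oblique_projr. Qed.

Lemma oblique_trace : \tr (oblique p Y) = \tr p.
Proof. by rewrite -oblique_projr mxtrace_mulC oblique_projl. Qed.

Lemma oblique_image : Y *m oblique p Y = oblique p Y.
Proof. by rewrite /oblique !mulmxA Yidem. Qed.

End Idempotents.

(** * Frames over a field *)

Section FieldFrames.

Variables (K : numFieldType) (n : nat) (p M P : 'M[K]_n).
Hypotheses (psym : p^T = p) (pidem : p *m p = p).
Hypotheses (symP : P^T = P) (idemP : P *m P = P) (trP : \tr P = \tr p).
Hypotheses (Munit : M \in unitmx) (PM : P *m M *m p = M *m p).

Lemma frame_absorb : p *m invmx M *m P = invmx M *m P.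
Proof.
have TP : M *m p *m invmx M *m P = P.
  apply: idempotent_absorb => //.
  - by rewrite !mulmxA mulmxKV // -(mulmxA M) pidem.
  - by rewrite !mulmxA PM.
  - by rewrite -mulmxA mxtrace_mulC mulmxKV.
by rewrite -{2}TP !mulmxA mulVmx // mul1mx.
Qed.

Lemma gden_frame : gden p M != 0.
Proof.
have [|z Ez] := gden_adapted psym pidem (mulmxV Munit) (mulVmx Munit) symP PM.
  exact: frame_absorb.
by apply: contra_eq_neq Ez => ->; rewrite mul0r !expr1n eq_sym oner_neq0.
Qed.

Lemma gnum_frame : (gden p M)^-1 *: gnum p M = P.
Proof.
have := gnum_adapted psym pidem (mulmxV Munit) symP PM frame_absorb.
by rewrite scale1r mul1r => ->; rewrite scalerA mulVf ?scale1r // gden_frame.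
Qed.

End FieldFrames.

(** * Coordinate blocks and the stages of a flag *)

Section Blocks.

Variables (r n : nat).

Section Ring.

Variables (B : comNzRingType) (b : 'I_n -> 'I_r.+1).

(** The coordinate projection onto the blocks 0, ..., i, where b distributes the
    coordinates over r + 1 blocks. Indices i >= r give the identity, in
    accordance with stage below. *)
Definition blockproj (i : nat) : 'M[B]_n := \matrix_(a, c) ((a == c) && (b a <= i)%N)%:R.

Lemma mul_blockproj m (M : 'M[B]_(m, n)) i a c :
  (M *m blockproj i) a c = if (b c <= i)%N then M a c else 0.
Proof.
rewrite mxE (bigD1 c) //= mxE eqxx /= big1 => [|e ec].
  by rewrite addr0; case: ifP => _; rewrite ?mulr1 ?mulr0.
by rewrite mxE (negPf ec) mulr0.
Qed.

Lemma tr_blockproj i : (blockproj i)^T = blockproj i.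
Proof. by apply/matrixP => a c; rewrite !mxE eq_sym; case: eqP => // ->. Qed.

Lemma blockprojM i j : (i <= j)%N -> blockproj j *m blockproj i = blockproj i.
Proof.
move=> ij; apply/matrixP => a c; rewrite mul_blockproj !mxE.
case: eqP => [->|_]; last by rewrite if_same.
by case: ifP => // ci; rewrite (leq_trans ci ij).
Qed.

Lemma blockproj_idem i : blockproj i *m blockproj i = blockproj i.
Proof. exact: blockprojM. Qed.

Lemma blockproj_top i : (r <= i)%N -> blockproj i = 1%:M.
Proof.
move=> ri; apply/matrixP => a c; rewrite !mxE.
by rewrite (leq_trans (leq_ord (b a)) ri) andbT.
Qed.

Lemma mxtrace_blockproj i : \tr (blockproj i) = #|[pred a | (b a <= i)%N]|%:R.
Proof.
rewrite /mxtrace -sum1_card natr_sum [RHS]big_mkcond /=.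
by apply: eq_bigr => a _; rewrite mxE eqxx inE; case: ifP.
Qed.

End Ring.

Lemma map_blockproj (B C : comNzRingType) (theta : {rmorphism B -> C}) b i :
  map_mx theta (blockproj B b i) = blockproj C b i.
Proof. by apply/matrixP => a c; rewrite !mxE rmorph_nat. Qed.

End Blocks.

Section Stages.

Variables (r n : nat).

(** The identity beyond the last member makes the differences of consecutive
    stages add up to 1. *)
Definition stage (B : comNzRingType) (P : 'I_r -> 'M[B]_n) (i : nat) : 'M[B]_n :=
  if insub i is Some j then P j else 1%:M.

Lemma stageE (B : comNzRingType) (P : 'I_r -> 'M[B]_n) (j : 'I_r) : stage P j = P j.
Proof. by rewrite /stage valK. Qed.

Lemma stage_top (B : comNzRingType) (P : 'I_r -> 'M[B]_n) i : (r <= i)%N -> stage P i = 1%:M.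
Proof. by move=> ri; rewrite /stage insubN // -leqNgt. Qed.

Lemma map_stage (B C : comNzRingType) (theta : {rmorphism B -> C})
    (P : 'I_r -> 'M[B]_n) i :
  map_mx theta (stage P i) = stage (fun j => map_mx theta (P j)) i.
Proof. by rewrite /stage; case: insub => // ; rewrite map_mx1. Qed.

(** Symmetry and the generators of the ideal, as equations over an arbitrary
    ring: only consecutive members of the flag are compared. *)
Record is_flag (B : comNzRingType) (k : 'I_r -> nat) (P : 'I_r -> 'M[B]_n) : Prop := IsFlag {
  flag_sym : forall i, (P i)^T = P i;
  flag_idem : forall i, P i *m P i = P i;
  flag_step : forall i j : 'I_r, i = j.+1 :> nat -> P i *m P j = P j;
  flag_trace : forall i, \tr (P i) = (k i)%:R }.

Variables (B : comNzRingType) (k : 'I_r -> nat) (P : 'I_r -> 'M[B]_n).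
Hypothesis flagP : is_flag k P.

Lemma stage_sym i : (stage P i)^T = stage P i.
Proof. by rewrite /stage; case: insub => [j|]; rewrite ?trmx1 ?(flag_sym flagP). Qed.

Lemma stageM i j : (i <= j)%N -> stage P j *m stage P i = stage P i.
Proof.
move=> /subnKC <-; elim: (j - i)%N => {j} [|m IHm].
  rewrite addn0 /stage; case: insub => [j|]; rewrite ?mulmx1 //.
  exact: flag_idem flagP j.
rewrite addnS; have [ge_r|lt_r] := leqP r (i + m).+1.
  by rewrite stage_top ?mul1mx.
pose a := Ordinal lt_r; pose c := Ordinal (ltnW lt_r).
have -> : stage P (i + m).+1 = P a by exact: (stageE P a).
rewrite -IHm mulmxA; have -> : stage P (i + m) = P c by exact: (stageE P c).
by rewrite (flag_step flagP (i := a) (j := c)).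
Qed.

Lemma stageMr i j : (i <= j)%N -> stage P i *m stage P j = stage P i.
Proof. by move=> ij; rewrite -{1}stage_sym -(stage_sym j) -trmx_mul stageM // stage_sym. Qed.

Definition piece_proj (i : nat) : 'M[B]_n :=
  stage P i - (if i is j.+1 then stage P j else 0).

Lemma stage_piece i l :
  stage P i *m piece_proj l = if (l <= i)%N then piece_proj l else 0.
Proof.
rewrite /piece_proj; case: l => [|l].
  by rewrite subr0 stageM.
rewrite mulmxBr; case: ltnP => [li|il].
  by rewrite !stageM // ltnW.
by rewrite !stageMr ?subrr // leqW.
Qed.

Lemma sum_piece : \sum_(l < r.+1) piece_proj l = 1%:M.
Proof.
have sumE m : \sum_(l < m.+1) piece_proj l = stage P m.
  elim: m => [|m IHm]; first by rewrite big_ord_recl big_ord0 addr0 /piece_proj subr0.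
  by rewrite big_ord_recr /= IHm /piece_proj addrC subrK.
by rewrite sumE stage_top.
Qed.

(** The columns assigned to a block lie in the image of the projection of that
    block, which is what makes the frame adapted to the flag. *)
Definition mixed_frame (b : 'I_n -> 'I_r.+1) : 'M[B]_n :=
  \matrix_(a, c) piece_proj (b c) a c.

Lemma stage_mixed_frame b i :
  stage P i *m mixed_frame b = mixed_frame b *m blockproj B b i.
Proof.
apply/matrixP => a c; rewrite mul_blockproj !mxE.
transitivity ((stage P i *m piece_proj (b c)) a c).
  by rewrite mxE; apply: eq_bigr => e _; rewrite mxE.
by rewrite stage_piece; case: ifP => _; rewrite ?mxE.
Qed.

(** Multilinearity of the determinant in the columns, applied to 1 as the sum of
    the projections piece_proj. *)
Lemma sum_det_mixed_frame : \sum_(b : {ffun 'I_n -> 'I_r.+1}) \det (mixed_frame b) = 1.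
Proof.
rewrite -[RHS](det1 B n) -[in RHS]sum_piece -[RHS]det_tr.
under eq_bigr => b _ do rewrite -det_tr /determinant.
rewrite /determinant exchange_big /=; apply: eq_bigr => s _.
rewrite -mulr_sumr; congr (_ * _).
under [in RHS]eq_bigr => a _ do rewrite mxE summxE.
rewrite bigA_distr_bigA /=; apply: eq_bigr => b _.
by apply: eq_bigr => a _; rewrite !mxE.
Qed.

(** Where the frame is invertible it conjugates each stage to a coordinate
    projection, so the traces agree. *)
Lemma det_mixed_frame_trace b (i : 'I_r) :
  \det (mixed_frame b) * (k i)%:R =
  \det (mixed_frame b) * #|[pred a | (b a <= i)%N]|%:R.
Proof.
rewrite -(mxtrace_blockproj B b i) -(flag_trace flagP) -(stageE P).
set W := mixed_frame b; rewrite -!mxtraceZ -!mul_mx_scalar.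
rewrite -{1}mul_mx_adj -mul_adj_mx mulmxA stage_mixed_frame -mulmxA mxtrace_mulC.
by rewrite mulmxA.
Qed.

End Stages.

(** * Ideals and quotient rings *)

Section Ideals.

Variable A : comNzRingType.
Implicit Types G I J : set A.

Lemma ideal_genP G g : G g -> ideal_gen G g.
Proof.
move=> Gg; exists [:: (1, g)]; split; last by rewrite big_seq1 mul1r.
by move=> t; rewrite inE => /eqP ->.
Qed.

Lemma ideal_gen0 G : ideal_gen G 0.
Proof. by exists [::]; rewrite big_nil. Qed.

Lemma ideal_genD G f g : ideal_gen G f -> ideal_gen G g -> ideal_gen G (f + g).
Proof.
move=> [s [sG ->]] [t [tG ->]]; exists (s ++ t); rewrite big_cat; split=> // u.
by rewrite mem_cat => /orP[/sG|/tG].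
Qed.

Lemma ideal_genM G a f : ideal_gen G f -> ideal_gen G (a * f).
Proof.
move=> [s [sG ->]]; exists [seq (a * t.1, t.2) | t <- s]; split.
  by move=> _ /mapP[t ts ->]; exact: (sG t ts).
by rewrite big_map mulr_sumr; apply: eq_bigr => t _; rewrite mulrA.
Qed.

Lemma ideal_gen_sub G (P : A -> Prop) :
  P 0 -> (forall f g, P f -> P g -> P (f + g)) -> (forall a f, P f -> P (a * f)) ->
  (forall g, G g -> P g) -> forall f, ideal_gen G f -> P f.
Proof.
move=> P0 PD PM PG _ [s [sG ->]]; rewrite big_seq.
elim/big_ind: _ => [//|//|t ts]; exact: PM (PG _ (sG _ ts)).
Qed.

Lemma quotient_morphism I : idealr_closed (mem I) ->
  exists (B : comNzRingType) (pi : {rmorphism A -> B}), forall x, pi x = 0 <-> I x.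
Proof.
move=> Iideal; pose S : A -> bool := fun x => x \in I.
have Sideal : idealr_closed S by [].
pose J : idealr A := HB.pack S (isIdealr.Build A S Sideal).
exists {ideal_quot J}, (\pi_{ideal_quot J})%qT => x.
have xJ : (x \in J) = (x \in I) by [].
rewrite -(in_setE I x) -xJ -[x in x \in J]subr0 Quotient.idealrBE.
pose pi0 := rmorph0 (\pi_{ideal_quot J})%qT.
by split=> [E|/eqP E]; [apply/eqP; exact: etrans E (esym pi0) | exact: etrans E pi0].
Qed.

End Ideals.

(** * Points of the projection flag variety over rings *)

Section FlagVariety.

Variables (r n : nat) (k : 'I_r -> nat).

Definition mats_of (B : Type) (y : 'I_(nvars r n) -> B) (i : 'I_r) : 'M[B]_n :=
  \matrix_(a, c) y (var_index i a c).

Lemma mats_ofK (B : Type) (y : 'I_(nvars r n) -> B) : coords (mats_of y) = y.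
Proof.
apply/funext => t; rewrite /coords mxE /var_index -[t in RHS]enum_valK.
case: (enum_val t) => i [[a c] /= ac]; congr (y (enum_rank (i, _))).
by apply: val_inj; rewrite /= /sort_pos ac.
Qed.

Lemma coordsK (B : Type) (P : 'I_r -> 'M[B]_n) :
  (forall i, (P i)^T = P i) -> mats_of (coords P) = P.
Proof.
move=> symP; apply/funext => i; apply/matrixP => a c.
rewrite mxE /coords enum_rankK /= /sort_pos.
by case: leqP => //= _; rewrite -[in LHS]symP mxE.
Qed.

Lemma mats_of_sym (B : Type) (y : 'I_(nvars r n) -> B) i : (mats_of y i)^T = mats_of y i.
Proof.
apply/matrixP => a c; rewrite !mxE; congr (y (enum_rank (i, _))).
by apply: val_inj; rewrite /= /sort_pos; case: ltngtP => // /val_inj ->.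
Qed.

Lemma pFlP (K : fieldType) (x : 'I_(nvars r n) -> K) :
  pFl K n k x <-> is_flag k (mats_of x).
Proof.
split=> [[P [symP PP] <-]|flagx].
  rewrite coordsK //; split=> // [i|i j ij|i].
  - by have [] := PP i i (leqnn i).
  - by have [] := PP i j; rewrite ?ij.
  - by have [] := PP i i (leqnn i).
exists (mats_of x); last exact: mats_ofK.
split=> [i|i j ji]; first exact: mats_of_sym.
split; last exact: flag_trace flagx i.
by rewrite -!stageE (stageM flagx).
Qed.

Section IdealPoints.

Variables (K : fieldType) (B : comNzRingType) (phi : {rmorphism K -> B}).
Variable y : 'I_(nvars r n) -> B.

Lemma map_unknown_mx i : map_mx (mmap phi y) (unknown_mx n K i) = mats_of y i.
Proof. by apply/matrixP => a c; rewrite !mxE mmapX mmap1U. Qed.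

Lemma flag_of_ideal :
  (forall f, pFl_ideal K n k f -> mmap phi y f = 0) -> is_flag k (mats_of y).
Proof.
move=> y0.
have genl f : flag_ideal K r n f -> mmap phi y f = 0.
  move=> ff; apply: y0; exists f => //.
  by exists 0; [exact: ideal_gen0|rewrite addr0].
have genr f : projection_ideal K n k f -> mmap phi y f = 0.
  by move=> ff; apply: y0; exists 0; [exact: ideal_gen0|]; exists f; rewrite ?add0r.
have mx0 (M N : 'M[{mpoly K[nvars r n]}]_n) :
    (forall a c, mmap phi y ((M - N) a c) = 0) -> map_mx (mmap phi y) M = map_mx (mmap phi y) N.
  move=> MN; apply/matrixP => a c; have := MN a c.
  by rewrite !mxE rmorphB => /eqP; rewrite subr_eq0 => /eqP.
split=> [i|i|i j ij|i]; first exact: mats_of_sym.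
- rewrite -!map_unknown_mx -map_mxM; apply: mx0 => a c.
  apply: genr; apply: ideal_genP; left.
  exists (unknown_mx n K i *m unknown_mx n K i - unknown_mx n K i), a, c.
  by split=> //; exists i.
- rewrite -!map_unknown_mx -map_mxM; apply: mx0 => a c.
  apply: genl; apply: ideal_genP.
  exists (unknown_mx n K i *m unknown_mx n K j - unknown_mx n K j), a, c.
  by split=> //; exists i, j.
- have : mmap phi y (\tr (unknown_mx n K i) - (k i)%:R) = 0.
    by apply: genr; apply: ideal_genP; right; exists i.
  rewrite rmorphB rmorph_nat => /eqP; rewrite subr_eq0 => /eqP <-.
  by rewrite -map_unknown_mx trace_map_mx.
Qed.

End IdealPoints.

Lemma pFl_ideal_vanishes (K : fieldType) f :
  pFl_ideal K n k f -> vanishing_ideal (pFl K n k) f.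
Proof.
move=> If x /pFlP xflag.
have mapU i : map_mx (meval x) (unknown_mx n K i) = mats_of x i.
  exact: (map_unknown_mx idfun x i).
have mx0 (M : 'M[{mpoly K[nvars r n]}]_n) a c : map_mx (meval x) M = 0 -> (M a c).@[x] = 0.
  by move/matrixP/(_ a c); rewrite !mxE.
case: If => f1 f1I [f2 f2I] <-; rewrite mevalD.
have sub G : (forall g : {mpoly K[nvars r n]}, G g -> g.@[x] = 0) ->
    forall g, ideal_gen G g -> g.@[x] = 0.
  move=> G0; apply: ideal_gen_sub => // [|g h g0 h0|a g g0]; first exact: meval0.
    by rewrite mevalD g0 h0 addr0.
  by rewrite mevalM g0 mulr0.
rewrite (sub _ _ _ f1I) ?(sub _ _ _ f2I) ?addr0 //.
  move=> g [[M [a [c [[i ->] ->]]]]|[i ->]].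
    by apply: mx0; rewrite map_mxB map_mxM mapU (flag_idem xflag) subrr.
  by rewrite mevalB rmorph_nat -(flag_trace xflag) -mapU trace_map_mx subrr.
move=> g [M [a [c [[i [j [ij ->]]] ->]]]].
by apply: mx0; rewrite map_mxB map_mxM !mapU (flag_step xflag ij) subrr.
Qed.

End FlagVariety.

(** * The rational map from frames to flags *)

Section FrameMaps.

Variables (r n : nat) (b : 'I_n -> 'I_r.+1).

Definition frame_den (B : comNzRingType) (M : 'M[B]_n) : B :=
  \prod_(j < r) gden (blockproj B b j) M.

(** The cofactor brings the i-th projection over the common denominator
    frame_den. *)
Definition frame_num (B : comNzRingType) (M : 'M[B]_n) (i : 'I_r) : 'M[B]_n :=
  (\prod_(j < r | j != i) gden (blockproj B b j) M) *: gnum (blockproj B b i) M.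

Lemma map_frame_den (B C : comNzRingType) (theta : {rmorphism B -> C}) M :
  theta (frame_den M) = frame_den (map_mx theta M).
Proof.
by rewrite rmorph_prod; apply: eq_bigr => j _; rewrite map_gden map_blockproj.
Qed.

Lemma map_frame_num (B C : comNzRingType) (theta : {rmorphism B -> C}) M i :
  map_mx theta (frame_num M i) = frame_num (map_mx theta M) i.
Proof.
rewrite /frame_num map_mxZ rmorph_prod map_gnum map_blockproj; congr (_ *: _).
by apply: eq_bigr => j _; rewrite map_gden map_blockproj.
Qed.

Definition frame_map (K : numFieldType) e (M : 'M[{mpoly K[e]}]_n) :
  ratmap K e (nvars r n) := RatMap (coords (frame_num M)) (frame_den M).

(** Over a ring in which det M need not be invertible, an adapted frame recovers
    the flag after multiplication by a power of det M, and its denominator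
    divides a power of det M. The pair M, det M times the adjugate of M, with
    product det M ^+ 2, is used in place of M, M^-1, because it satisfies the
    adaptation hypothesis without dividing. *)
Lemma adapted_frame_ring (B : comNzRingType) (k : 'I_r -> nat)
    (P : 'I_r -> 'M[B]_n) (M : 'M[B]_n) :
  is_flag k P -> (forall i : 'I_r, P i *m M = M *m blockproj B b i) ->
  (forall i, (\det M ^+ 2) *: frame_num M i = (\det M ^+ 2 * frame_den M) *: P i) /\
  exists z m, frame_den M * z = \det M ^+ m.
Proof.
move=> flagP PM; pose M' := \det M *: \adj M.
have MM' : M *m M' = (\det M ^+ 2)%:M.
  by rewrite -scalemxAr mul_mx_adj scale_scalar_mx expr2.
have M'M : M' *m M = (\det M ^+ 2)%:M.
  by rewrite -scalemxAl mul_adj_mx scale_scalar_mx expr2.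
have PMp (i : 'I_r) : P i *m M *m blockproj B b i = M *m blockproj B b i.
  by rewrite PM -mulmxA blockproj_idem.
have M'P (i : 'I_r) : M' *m P i = \det M *: (blockproj B b i *m \adj M).
  rewrite -scalemxAl -mul_mx_scalar -(mul_mx_adj M) mulmxA -(mulmxA _ (P i)) PM mulmxA.
  by rewrite mul_adj_mx mul_scalar_mx scalemxAl.
have pM'P (i : 'I_r) : blockproj B b i *m M' *m P i = M' *m P i.
  by rewrite -mulmxA M'P -scalemxAr mulmxA blockproj_idem.
split=> [i|].
  have := gnum_adapted (tr_blockproj B b i) (blockproj_idem B b i) MM' (flag_sym flagP i)
    (PMp i) (pM'P i).
  move=> E; rewrite /frame_num /frame_den [in RHS](bigD1 i) //=.
  by rewrite scalerA mulrC -[LHS]scalerA E scalerA; congr (_ *: _); ring.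
have den_z (i : 'I_r) := gden_adapted (tr_blockproj B b i) (blockproj_idem B b i) MM' M'M
  (flag_sym flagP i) (PMp i) (pM'P i).
rewrite /frame_den; elim/big_ind: _ => [|x y [z [m xz]] [t [l yt]]|i _].
- by exists 1, 0; rewrite mulr1.
- by exists (z * t), (m + l)%N; rewrite mulrACA xz yt exprD.
have [z Ez] := den_z i; exists z, (2 * 2 * n)%N.
by rewrite Ez !exprM.
Qed.

Variables (K : numFieldType) (k : 'I_r -> nat).
Hypothesis bk : forall i : 'I_r, #|[pred a | (b a <= i)%N]| = k i.

Definition frame_flag (M : 'M[K]_n) (i : 'I_r) : 'M[K]_n :=
  (gden (blockproj K b i) M)^-1 *: gnum (blockproj K b i) M.

Lemma frame_den_neq0 M (i : 'I_r) : frame_den M != 0 -> gden (blockproj K b i) M != 0.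
Proof. by move/prodf_neq0; apply. Qed.

Lemma frame_flag_image M (i : 'I_r) : frame_den M != 0 ->
  frame_flag M i *m M *m blockproj K b i = M *m blockproj K b i.
Proof.
move=> /(frame_den_neq0 i) M0; rewrite -!scalemxAl.
rewrite gnum_fix ?tr_blockproj ?blockproj_idem //.
by rewrite scalerA mulVf // scale1r.
Qed.

Lemma frame_flagP M : frame_den M != 0 -> is_flag k (frame_flag M).
Proof.
move=> M0.
have absorb (i j : 'I_r) : (i <= j)%N -> frame_flag M j *m frame_flag M i = frame_flag M i.
  move=> ij; rewrite {2 3}/frame_flag -scalemxAr; congr (_ *: _).
  rewrite /gnum !mulmxA; do 3! congr (_ *m _).
  by rewrite -(blockprojM K b ij) !mulmxA frame_flag_image.
split=> [i|i|i j ij|i].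
- by rewrite linearZ /= gnum_sym ?tr_blockproj ?blockproj_idem.
- exact: absorb.
- by apply: absorb; rewrite ij.
rewrite mxtraceZ mxtrace_gnum ?tr_blockproj ?blockproj_idem //.
by rewrite mulKf ?frame_den_neq0 // mxtrace_blockproj bk.
Qed.

Lemma reval_frame_map e (M : 'M[{mpoly K[e]}]_n) u :
  (rden (frame_map M)).@[u] != 0 ->
  reval (frame_map M) u = coords (frame_flag (map_mx (meval u) M)).
Proof.
rewrite /= (map_frame_den (meval u)) => M0; apply/funext => t.
rewrite /reval /= (map_frame_den (meval u)) /coords; set a := enum_val t.
have -> : (frame_num M a.1 (sval a.2).1 (sval a.2).2).@[u] =
    map_mx (meval u) (frame_num M a.1) (sval a.2).1 (sval a.2).2 by rewrite [RHS]mxE.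
rewrite map_frame_num; move: (map_mx _ M) M0 => G M0.
rewrite [frame_num _ _ _ _]mxE [frame_flag _ _ _ _]mxE.
move: M0; rewrite /frame_den (bigD1 a.1) //= mulf_eq0 negb_or => /andP[d0 d1].
by move: (gnum _ _ _ _) => N; field; rewrite d0 d1.
Qed.

Lemma frame_map_pFl e (M : 'M[{mpoly K[e]}]_n) u :
  (rden (frame_map M)).@[u] != 0 -> pFl K n k (reval (frame_map M) u).
Proof.
move=> M0; rewrite reval_frame_map //; move: M0; rewrite /= (map_frame_den (meval u)).
move/frame_flagP => flagM; apply/pFlP; rewrite coordsK //.
by move=> i; apply: flag_sym flagM i.
Qed.

(** Over a field it is enough that the leading columns of M span the subspaces
    of the flag; equality of traces gives the reverse inclusion of images. *)
Lemma adapted_frame (P : 'I_r -> 'M[K]_n) M :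
  is_flag k P -> M \in unitmx ->
  (forall i : 'I_r, P i *m M *m blockproj K b i = M *m blockproj K b i) ->
  frame_den M != 0 /\ frame_flag M = P.
Proof.
move=> flagP Mu PM.
have tr (i : 'I_r) : \tr (P i) = \tr (blockproj K b i).
  by rewrite (flag_trace flagP) mxtrace_blockproj bk.
split.
  apply/prodf_neq0 => i _.
  exact: gden_frame (tr_blockproj K b i) (blockproj_idem K b i) (flag_sym flagP i)
    (flag_idem flagP i) (tr i) Mu (PM i).
apply/funext => i.
exact: gnum_frame (tr_blockproj K b i) (blockproj_idem K b i) (flag_sym flagP i)
    (flag_idem flagP i) (tr i) Mu (PM i).
Qed.

End FrameMaps.

(** * The generic frame *)

Section GenericFrame.

Variables (r n : nat) (b : 'I_n -> 'I_r.+1) (K : numFieldType).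

Definition generic_mx : 'M[{mpoly K[n * n]}]_n := \matrix_(a, c) 'X_(mxvec_index a c).

Lemma map_generic_mx (B : comNzRingType) (phi : {rmorphism K -> B}) (M : 'M[B]_n) :
  map_mx (mmap phi (mxvec M 0)) generic_mx = M.
Proof. by apply/matrixP => a c; rewrite !mxE mmapX mmap1U mxvecE. Qed.

Definition generic_frame := frame_map b generic_mx.

End GenericFrame.

(** * The vanishing ideal and its primality *)

Section VanishingIdeal.

Variables (r n : nat) (K : numFieldType) (k : 'I_r -> nat).
Hypothesis k_incr : forall i j : 'I_r, (i < j)%N -> (k i < k j)%N.
Hypothesis k_le_n : forall i : 'I_r, (k i <= n)%N.

(** Coordinate a goes to the block numbered by how many k_i are at most a;
    blocks 0, ..., i then consist of the coordinates below k_i. *)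
Lemma standard_blocks : exists b : 'I_n -> 'I_r.+1,
  forall i : 'I_r, #|[pred a | (b a <= i)%N]| = k i.
Proof.
have lt_r (a : 'I_n) : (#|[pred i : 'I_r | (k i <= a)%N]| < r.+1)%N.
  by rewrite ltnS -[r in leqRHS]card_ord max_card.
exists (fun a => Ordinal (lt_r a)) => i /=.
have bE (a : 'I_n) : (#|[pred j : 'I_r | (k j <= a)%N]| <= i)%N = (a < k i)%N.
  apply/idP/idP => [|a_lt].
    apply: contraTT; rewrite -leqNgt -ltnNge => ka.
    have w_inj : injective (widen_ord (ltn_ord i)) by move=> x y /(congr1 val) /= /val_inj.
    rewrite -[i.+1]card_ord -(card_imset _ w_inj); apply: subset_leq_card.
    apply/fintype.subsetP => _ /imsetP[j _ ->]; rewrite inE; apply: leq_trans ka.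
    have : (j <= i)%N by rewrite -ltnS ltn_ord.
    rewrite leq_eqVlt => /orP[/eqP ji|ji]; last exact/ltnW/k_incr.
    by rewrite (_ : widen_ord _ j = i) //; apply: val_inj.
  have w_inj : injective (widen_ord (ltnW (ltn_ord i))) by move=> x y /(congr1 val) /= /val_inj.
  rewrite -[leqRHS]card_ord -(card_imset _ w_inj); apply: subset_leq_card.
  apply/fintype.subsetP => j; rewrite inE => kj.
  have ji : (j < i)%N.
    rewrite ltnNge; apply: contraTN a_lt; rewrite -leqNgt leq_eqVlt => /orP[/eqP ij|ij].
      by rewrite (_ : i = j) //; apply: val_inj.
    by apply: leq_trans kj; apply/ltnW/k_incr.
  by apply/imsetP; exists (Ordinal ji) => //; apply: val_inj.
rewrite (eq_card (B := [pred a : 'I_n | (a < k i)%N])) => [|a]; last by rewrite !inE bE.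
pose w := widen_ord (k_le_n i).
have w_inj : injective w by move=> x y /(congr1 val) /= /val_inj.
rewrite -[RHS]card_ord -(card_imset _ w_inj); apply: eq_card => a.
rewrite inE; apply/idP/imsetP => [ak|[c _ ->]]; last exact: (ltn_ord c).
by exists (Ordinal ak) => //; apply: val_inj.
Qed.

Lemma pFl_nonempty : pFl K n k !=set0.
Proof.
have [b bk] := standard_blocks.
exists (reval (generic_frame b K) (mxvec (1%:M : 'M[K]_n) 0)); apply: frame_map_pFl bk _ _ _ _.
rewrite /= (map_frame_den b (meval _)) /meval (map_generic_mx idfun).
apply/prodf_neq0 => i _; rewrite /gden /gram trmx1 !mulmx1 blockproj_idem.
by rewrite addrC subrK det1 oner_neq0.
Qed.

Lemma pFl_ideal_closed : idealr_closed (mem (pFl_ideal K n k)).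
Proof.
split; rewrite ?in_setE.
- by exists 0; [exact: ideal_gen0|]; exists 0; [exact: ideal_gen0|rewrite addr0].
- apply/negP; rewrite in_setE => /pFl_ideal_vanishes I1.
  have [x /I1] := pFl_nonempty; rewrite meval1 => /eqP.
  by rewrite oner_eq0.
move=> a _ _ /set_mem[f1 I1 [f2 I2 <-]] /set_mem[g1 J1 [g2 J2 <-]]; apply/mem_set.
exists (a * f1 + g1); first by apply: ideal_genD => //; apply: ideal_genM.
exists (a * f2 + g2); first by apply: ideal_genD => //; apply: ideal_genM.
by rewrite mulrDr addrACA.
Qed.

(** A difference of sizes would be an invertible scalar annihilating the
    determinant, by det_mixed_frame_trace. *)
Lemma mixed_frame_sizes (B : comNzRingType) (phi : {rmorphism K -> B})
    (P : 'I_r -> 'M[B]_n) b :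
  is_flag k P -> \det (mixed_frame P b) != 0 ->
  forall i : 'I_r, #|[pred a | (b a <= i)%N]| = k i.
Proof.
move=> flagP d0 i; apply/eqP; apply: contraNT d0 => sizes.
have /eqP := det_mixed_frame_trace flagP b i.
rewrite -subr_eq0 -mulrBr -!(rmorph_nat phi) -rmorphB => /eqP E.
have nz : ((k i)%:R - #|[pred a | (b a <= i)%N]|%:R : K) != 0.
  by rewrite subr_eq0 Num.Theory.eqr_nat eq_sym.
have := congr1 (fun z => z * phi (((k i)%:R - #|[pred a | (b a <= i)%N]|%:R)^-1)) E.
by rewrite /= -mulrA -rmorphM mulfV // rmorph1 mulr1 mul0r => ->.
Qed.

(** The elements of B having a power that kills f(y) form an ideal; it contains
    every det W_b, hence their sum 1. *)
Lemma vanishing_at_ring_points (B : comNzRingType) (phi : {rmorphism K -> B})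
    (y : 'I_(nvars r n) -> B) f :
  is_flag k (mats_of y) -> vanishing_ideal (pFl K n k) f -> mmap phi y f = 0.
Proof.
move=> flagy fX.
pose J (z : B) := exists m, z ^+ m * mmap phi y f = 0.
have JD z w : J z -> J w -> J (z + w).
  move=> [m zm] [l wl]; exists (m + l)%N; rewrite exprDn mulr_suml big1 // => j _.
  have [lj|jl] := leqP l j.
    rewrite mulrnAl -(subnK lj) exprD -!mulrA wl !mulr0 mul0rn //.
  have mj : (m <= m + l - j)%N by rewrite -addnBA ?leq_addr // ltnW.
  rewrite mulrnAl -(subnK mj) exprD mulrAC -(mulrA _ (z ^+ m)) zm.
  by rewrite !(mulr0, mul0r, mul0rn).
suff : J 1 by case=> m; rewrite expr1n mul1r.
rewrite -(sum_det_mixed_frame (mats_of y)); elim/big_ind: _ => [|z w Jz Jw|b _].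
- by exists 1; rewrite expr1 mul0r.
- exact: JD.
set W := mixed_frame (mats_of y) b.
have [->|W0] := eqVneq (\det W) 0; first by exists 1; rewrite expr1 mul0r.
have bk := mixed_frame_sizes phi flagy W0.
pose g := generic_frame b K; pose D := msize f.
(* Over K the frame map takes its values in the variety, so f vanishes
   identically along it; this is an identity between polynomials in the
   entries of a generic matrix, to be specialized at W. *)
have F0 : rden g * pull D g f = 0.
  apply: mpoly_eq0P => u; rewrite mevalM.
  have [->|gu] := eqVneq (rden g).@[u] 0; first by rewrite mul0r.
  by rewrite meval_pull // fX ?mulr0 //; apply: frame_map_pFl bk _ _ _ gu.
have WP (i : 'I_r) : mats_of y i *m W = W *m blockproj B b i.
  by rewrite -(stage_mixed_frame flagy) stageE.
have [numW [z [m denW]]] := adapted_frame_ring flagy WP.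
pose u : 'I_(n * n) -> B := mxvec W 0.
have denE : mmap phi u (rden g) = frame_den b W.
  by rewrite /= (map_frame_den b (mmap phi u)) map_generic_mx.
have numE t : \det W ^+ 2 * mmap phi u (rnum g t) =
    \det W ^+ 2 * (mmap phi u (rden g) * y t).
  rewrite denE -[in RHS](mats_ofK y) /= /coords; set a := enum_val t.
  have -> : mmap phi u (frame_num b (generic_mx n K) a.1 (sval a.2).1 (sval a.2).2) =
      map_mx (mmap phi u) (frame_num b (generic_mx n K) a.1) (sval a.2).1 (sval a.2).2.
    by rewrite [RHS]mxE.
  rewrite map_frame_num map_generic_mx mulrA.
  by have /matrixP/(_ (sval a.2).1 (sval a.2).2) := numW a.1; rewrite !mxE.
have /(congr1 (fun w => mmap phi u (rden g) * w)) := mmap_pull numE (leqnSn D).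
rewrite mulrCA -rmorphM F0 rmorph0 mulr0 denE => E.
exists (2 + m * D.+1)%N; rewrite exprD exprM -denW.
move: (frame_den b W) (\det W ^+ 2) (mmap phi y f) E => delta c F E.
transitivity (z ^+ D.+1 * (delta * (c * (delta ^+ D * F)))); last by rewrite -E mulr0.
rewrite exprMn (exprS delta); move: (z ^+ _) (delta ^+ _) => t s; ring.
Qed.

(** The tautological point of the quotient by the ideal is a flag, so a
    polynomial vanishing on the variety vanishes there, that is, it lies in the
    ideal. *)
Theorem vanishing_ideal_pFl : vanishing_ideal (pFl K n k) = pFl_ideal K n k.
Proof.
apply/seteqP; split=> f; last exact: pFl_ideal_vanishes.
have [B [pi piP]] := quotient_morphism pFl_ideal_closed.
move=> fX; apply/piP.
pose y t := pi 'X_t; pose phi := pi \o @mpolyC (nvars r n) K.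
have piE g : pi g = mmap phi y g by exact: rmorph_mpolyE.
rewrite piE; apply: vanishing_at_ring_points fX.
by apply: (flag_of_ideal (phi := phi)) => g /piP; rewrite piE.
Qed.

(** The fibres of b and b' over each block have equal sizes, as differences of
    the given counts. *)
Lemma blocks_permutation (b b' : 'I_n -> 'I_r.+1) :
  (forall i : 'I_r, #|[pred a | (b a <= i)%N]| = #|[pred a | (b' a <= i)%N]|) ->
  exists s : 'S_n, forall a, b a = b' (s a).
Proof.
move=> sizes.
have sizes_nat i : #|[pred a | (b a <= i)%N]| = #|[pred a | (b' a <= i)%N]|.
  have [ri|ir] := leqP r i; last exact: sizes (Ordinal ir).
  by apply: eq_card => a; rewrite !inE !(leq_trans (leq_ord _) ri).
have fibre (c : 'I_n -> 'I_r.+1) (l : 'I_r.+1) : #|[pred a | c a == l]| =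
    (#|[pred a | (c a <= l)%N]| - (if l : nat is m.+1 then #|[pred a | (c a <= m)%N]| else 0))%N.
  case: l => -[|m] lt_m /=.
    by rewrite subn0; apply: eq_card => a; rewrite !inE leqn0.
  rewrite -[in RHS](cardID [pred a | (c a <= m)%N] [pred a | (c a <= m.+1)%N]).
  rewrite [X in (X + _ - _)%N](_ : _ = #|[pred a | (c a <= m)%N]|); last first.
    apply: eq_card => a; rewrite !inE; apply/idP/idP => [/andP[]//|le_m].
    by rewrite le_m (leqW le_m).
  rewrite addKn; apply: eq_card => a; rewrite !inE -ltnNge -val_eqE /=.
  by rewrite eqn_leq andbC.
have /tuple_permP[s sE] : perm_eq [tuple b a | a < n] [tuple b' a | a < n].
  have cE (c : 'I_n -> 'I_r.+1) l : count_mem l [tuple c a | a < n] = #|[pred a | c a == l]|.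
    by rewrite !count_map cardE /enum_mem size_filter; apply: eq_count.
  apply/allP => l _; rewrite /= !cE !fibre sizes_nat; apply/eqP.
  by case: (l : nat) => // m; rewrite (sizes_nat m).
exists s => a; have /(congr1 (fun t : seq 'I_r.+1 => nth ord0 t a)) := sE.
by rewrite -!tnth_nth !tnth_mktuple.
Qed.

(** Some mixed frame is invertible since their determinants add up to 1;
    permuting its columns gives the prescribed blocks. *)
Lemma adapted_frame_exists (b : 'I_n -> 'I_r.+1) (P : 'I_r -> 'M[K]_n) :
  (forall i : 'I_r, #|[pred a | (b a <= i)%N]| = k i) -> is_flag k P ->
  exists2 M : 'M[K]_n, M \in unitmx &
    forall i : 'I_r, P i *m M = M *m blockproj K b i.
Proof.
move=> bk flagP.
have [b' W0] : exists b' : {ffun 'I_n -> 'I_r.+1}, \det (mixed_frame P b') != 0.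
  apply: contrapT => /forallNP W0; have /eqP := sum_det_mixed_frame P.
  rewrite big1 1?eq_sym ?oner_eq0 // => b' _.
  by apply/eqP; rewrite -[_ == _]negbK; apply/negP/W0.
have b'k := mixed_frame_sizes idfun flagP W0.
have [s bs] : exists s : 'S_n, forall a, b a = b' (s a).
  by apply: blocks_permutation => i; rewrite bk b'k.
exists (col_perm s (mixed_frame P b')).
  rewrite col_permE unitmx_mul unitmx_perm andbT.
  by rewrite unitmxE unitfE.
move=> i; rewrite col_permE mulmxA -(stageE P) (stage_mixed_frame flagP) -col_permE.
apply/matrixP => a c; rewrite mul_blockproj -col_permE.
by rewrite [LHS]mxE mul_blockproj bs; case: ifP => //; rewrite [in RHS]mxE.
Qed.

Theorem pFl_ideal_prime : prime_ideal (pFl_ideal K n k).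
Proof.
split; first exact: pFl_ideal_closed.
have [b bk] := standard_blocks.
move=> f1 f2; rewrite -vanishing_ideal_pFl !in_setE => f12.
pose g := generic_frame b K.
have g_onto x : pFl K n k x -> exists2 u, (rden g).@[u] != 0 & reval g u = x.
  move=> /pFlP flagx; have [M Mu PM] := adapted_frame_exists bk flagx.
  have [i|M0 MP] := adapted_frame bk flagx Mu.
    by rewrite PM -mulmxA blockproj_idem.
  have mapM : map_mx (meval (mxvec M 0)) (generic_mx n K) = M by exact: (map_generic_mx idfun).
  have gM : (rden g).@[mxvec M 0] != 0 by rewrite /= (map_frame_den b (meval _)) mapM.
  by exists (mxvec M 0); rewrite // reval_frame_map // mapM MP mats_ofK.
have [//|u _ gu|fi0|fi0] := @ratmap_image_prime K _ _ g setT _ f1 f2.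
- by apply: f12; apply: frame_map_pFl bk _ _ _ gu.
- by apply/orP; left; apply/mem_set => x /g_onto[u gu <-]; apply: fi0.
- by apply/orP; right; apply/mem_set => x /g_onto[u gu <-]; apply: fi0.
Qed.

End VanishingIdeal.

Lemma pFl_closed (r n : nat) (K : fieldType) (k : 'I_r -> nat) :
  zariski_closed (pFl K n k).
Proof.
exists (pFl_ideal K n k); apply/seteqP; split=> x Xx.
  by move=> f /pFl_ideal_vanishes; apply.
by apply/pFlP; apply: (flag_of_ideal (phi := idfun)).
Qed.

(** * Charts of the flag variety *)

Section FlagChart.

Variables (r n : nat) (b : 'I_n -> 'I_r.+1).

Definition lower_pos := {ac : 'I_n * 'I_n | (b ac.2 < b ac.1)%N}.

(** Strictly lower block triangular matrices, with exactly one coordinate for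
    each position below the diagonal blocks. *)
Definition lower_mx (B : comNzRingType) (u : 'I_#|{: lower_pos}| -> B) : 'M[B]_n :=
  \matrix_(a, c) if insub (a, c) is Some s then u (enum_rank (s : lower_pos)) else 0.

Lemma lower_mx_pos (B : comNzRingType) (u : 'I_#|{: lower_pos}| -> B) (s : lower_pos) :
  lower_mx u (sval s).1 (sval s).2 = u (enum_rank s).
Proof. by rewrite mxE -surjective_pairing valK. Qed.

Lemma lower_mx0 (B : comNzRingType) (u : 'I_#|{: lower_pos}| -> B) a c :
  (b a <= b c)%N -> lower_mx u a c = 0.
Proof. by move=> ac; rewrite mxE insubN // -leqNgt. Qed.

Lemma map_lower_mx (B C : comNzRingType) (theta : {rmorphism B -> C})
    (u : 'I_#|{: lower_pos}| -> B) :
  map_mx theta (lower_mx u) = lower_mx (theta \o u).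
Proof. by apply/matrixP => a c; rewrite !mxE; case: insub => [s|] //=; rewrite rmorph0. Qed.

Lemma blockproj_mul (B : comNzRingType) m (M : 'M[B]_(n, m)) i a c :
  (blockproj B b i *m M) a c = if (b a <= i)%N then M a c else 0.
Proof.
have -> : blockproj B b i *m M = (M^T *m blockproj B b i)^T.
  by rewrite trmx_mul trmxK tr_blockproj.
by rewrite mxE mul_blockproj mxE.
Qed.

Variables (K : numFieldType) (k : 'I_r -> nat).
Hypothesis bk : forall i : 'I_r, #|[pred a | (b a <= i)%N]| = k i.

Local Notation p i := (blockproj K b i).
Local Notation d := #|{: lower_pos}|.

(** If v is in the left kernel, its entries vanish block by block, starting from
    the last block. *)
Lemma unipotent_unit (u : 'I_d -> K) : 1%:M + lower_mx u \in unitmx.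
Proof.
rewrite -row_free_unit; apply: inj_row_free => v vS.
suff v0 m c : (r - b c < m)%N -> v 0 c = 0.
  by apply/rowP => c; rewrite mxE (v0 r.+1) // ltnS leq_subr.
elim: m c => // m IHm c lt_c.
have /rowP/(_ c) := vS; rewrite mulmxDr mulmx1 !mxE big1 ?addr0 // => a _.
have [ac|ca] := leqP (b a) (b c); first by rewrite lower_mx0 ?mulr0.
rewrite IHm ?mul0r //; apply: leq_trans (_ : (r - b c <= m)%N) => //.
by rewrite ltn_sub2l // (leq_trans ca) // leq_ord.
Qed.

Variable M0 : 'M[K]_n.
Hypothesis M0unit : M0 \in unitmx.

Definition chart_mx : 'M[{mpoly K[d]}]_n :=
  map_mx (@mpolyC d K) M0 *m (1%:M + lower_mx (fun i => 'X_i)).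

Lemma map_chart_mx u : map_mx (meval u) chart_mx = M0 *m (1%:M + lower_mx u).
Proof.
rewrite map_mxM map_mxD map_mx1 map_lower_mx; congr (_ *m (_ + _)).
  by apply/matrixP => a c; rewrite !mxE /= mevalC.
by congr lower_mx; apply/funext => i; rewrite /= mevalXU.
Qed.

Definition flag_chart : ratmap K d (nvars r n) := frame_map b chart_mx.

(** The stages of the flag in the basis M0; at the center of the chart they are
    coordinate projections. *)
Definition conj_stage (x : 'I_(nvars r n) -> K) i : 'M[K]_n :=
  invmx M0 *m stage (mats_of x) i *m M0.

Definition generic_stage i : 'M[{mpoly K[nvars r n]}]_n :=
  map_mx (@mpolyC (nvars r n) K) (invmx M0) *m stage (unknown_mx n K) i *m
  map_mx (@mpolyC (nvars r n) K) M0.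

Lemma map_generic_stage x i : map_mx (meval x) (generic_stage i) = conj_stage x i.
Proof.
have mapC (M : 'M[K]_n) : map_mx (meval x) (map_mx (@mpolyC (nvars r n) K) M) = M.
  by apply/matrixP => a c; rewrite !mxE /= mevalC.
rewrite /generic_stage !map_mxM !mapC map_stage; congr (_ *m stage _ _ *m _).
by apply/funext => j; apply: (map_unknown_mx idfun).
Qed.

Definition oblique_gram (B : comNzRingType) i (Y : 'M[B]_n) : 'M[B]_n :=
  blockproj B b i *m Y *m blockproj B b i + (1%:M - blockproj B b i).

Lemma map_oblique_gram (B C : comNzRingType) (theta : {rmorphism B -> C}) i Y :
  map_mx theta (oblique_gram i Y) = oblique_gram i (map_mx theta Y).
Proof. by rewrite /oblique_gram map_mxD map_mxB !map_mxM map_mx1 !map_blockproj. Qed.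

Definition oblique_num (B : comNzRingType) i (Y : 'M[B]_n) : 'M[B]_n :=
  Y *m blockproj B b i *m \adj (oblique_gram i Y).

Lemma map_oblique_num (B C : comNzRingType) (theta : {rmorphism B -> C}) i Y :
  map_mx theta (oblique_num i Y) = oblique_num i (map_mx theta Y).
Proof. by rewrite /oblique_num !map_mxM map_mx_adj map_blockproj map_oblique_gram. Qed.

Lemma oblique_numE i (Y : 'M[K]_n) a c : oblique_gram i Y \in unitmx ->
  oblique (p i) Y a c = oblique_num i Y a c / \det (oblique_gram i Y).
Proof.
rewrite /oblique /oblique_num -/(oblique_gram i Y) /invmx => ->.
by rewrite -scalemxAr mxE mulrC.
Qed.

(** The entry (a, c) of the chart parameter is read off the oblique projection
    attached to the block of c; only blocks below r have positions below them,
    so the product over j < r is a common denominator. *)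
Definition flag_coords : ratmap K (nvars r n) d := RatMap
  (fun t => let: (a, c) := sval (enum_val t) in
    (\prod_(j < r | (j != b c :> nat)%N) \det (oblique_gram j (generic_stage j))) *
    oblique_num (b c) (generic_stage (b c)) a c)
  (\prod_(j < r) \det (oblique_gram j (generic_stage j))).

Lemma meval_det_oblique_gram x i :
  (\det (oblique_gram i (generic_stage i))).@[x] = \det (oblique_gram i (conj_stage x i)).
Proof. by rewrite -(det_map_mx (meval x)) map_oblique_gram map_generic_stage. Qed.

Lemma meval_oblique_num x i a c :
  (oblique_num i (generic_stage i) a c).@[x] = oblique_num i (conj_stage x i) a c.
Proof. by rewrite -map_generic_stage -map_oblique_num [RHS]mxE. Qed.

Lemma rden_flag_coords x : (rden flag_coords).@[x] =
  \prod_(j < r) \det (oblique_gram j (conj_stage x j)).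
Proof. by rewrite rmorph_prod; apply: eq_bigr => j _; apply: meval_det_oblique_gram. Qed.

Lemma rnum_flag_coords x (s : lower_pos) (a := (sval s).1) (c := (sval s).2) :
  (rnum flag_coords (enum_rank s)).@[x] =
  (\prod_(j < r | (j != b c :> nat)%N) \det (oblique_gram j (conj_stage x j))) *
  oblique_num (b c) (conj_stage x (b c)) a c.
Proof.
rewrite /a /c /= enum_rankK; case: (sval s) => /= e f.
rewrite mevalM meval_oblique_num rmorph_prod; congr (_ * _).
by apply: eq_bigr => j _; apply: meval_det_oblique_gram.
Qed.

Lemma oblique_gram_unit x i :
  (rden flag_coords).@[x] != 0 -> oblique_gram i (conj_stage x i) \in unitmx.
Proof.
rewrite rden_flag_coords => /prodf_neq0 h0; have [ri|ir] := leqP r i.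
  rewrite /oblique_gram /conj_stage stage_top // blockproj_top // !mulmx1 mul1mx.
  by rewrite mulVmx // subrr addr0 unitmx1.
by rewrite unitmxE unitfE; apply: (h0 (Ordinal ir)).
Qed.

Lemma reval_flag_coords x (s : lower_pos) : (rden flag_coords).@[x] != 0 ->
  reval flag_coords x (enum_rank s) =
  oblique (p (b (sval s).2)) (conj_stage x (b (sval s).2)) (sval s).1 (sval s).2.
Proof.
move=> hx; rewrite oblique_numE; last exact: oblique_gram_unit.
rewrite /reval rnum_flag_coords rden_flag_coords.
have lt_r : (b (sval s).2 < r)%N by apply: leq_trans (valP s) (leq_ord _).
move: hx; rewrite rden_flag_coords (bigD1 (Ordinal lt_r)) //=.
rewrite mulf_eq0 negb_or => /andP[d0 d1].
by rewrite invfM [X in X * _]mulrC mulrACA mulfV ?mulr1.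
Qed.

Lemma conj_stage_idem x i : is_flag k (mats_of x) ->
  conj_stage x i *m conj_stage x i = conj_stage x i.
Proof.
move=> flagx; rewrite /conj_stage -!mulmxA (mulmxA M0) mulmxV // mul1mx.
by rewrite (mulmxA (stage _ _) (stage _ _)) (stageM flagx).
Qed.

(** The matrix S with columns taken from the oblique projections T_i is 1 + L:
    each T_i is the identity on the blocks up to i, modulo later blocks. Its
    first columns lie in the image of the i-th stage, so M0 S is a frame of the
    flag. *)
Lemma flag_chart_coords x : pFl K n k x -> (rden flag_coords).@[x] != 0 ->
  (rden flag_chart).@[reval flag_coords x] != 0 /\
  reval flag_chart (reval flag_coords x) = x.
Proof.
move=> /pFlP flagx hx; set u := reval flag_coords x.
pose S := 1%:M + lower_mx u; pose T i := oblique (p i) (conj_stage x i).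
have Tunit i := oblique_gram_unit i hx.
have SE a c : S a c = T (b c) a c.
  have [ac|ca] := leqP (b a) (b c).
    rewrite [LHS]mxE lower_mx0 // addr0.
    have := oblique_projl (blockproj_idem K b (b c)) (Tunit (b c)).
    move/(congr1 (fun N : 'M[K]_n => N a c)).
    by rewrite blockproj_mul ac => ->; rewrite !mxE ac andbT.
  rewrite [LHS]mxE [X in X + _]mxE (_ : a == c = false) ?add0r; last first.
    by apply/eqP => ac; rewrite ac ltnn in ca.
  pose s : lower_pos := exist _ (a, c) ca.
  by rewrite (lower_mx_pos u s) /u reval_flag_coords.
have PM (i : 'I_r) : mats_of x i *m (M0 *m S) *m p i = M0 *m S *m p i.
  have YS : conj_stage x i *m S *m p i = S *m p i.
    apply/matrixP => a c; rewrite !mul_blockproj; case: ifP => // ci.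
    rewrite SE mxE; under eq_bigr => e _ do rewrite SE.
    transitivity ((conj_stage x i *m T (b c)) a c); first by rewrite mxE.
    rewrite -[T _](oblique_image (p (b c)) (conj_stage_idem (b c) flagx)).
    rewrite mulmxA; congr ((_ *m _) a c).
    rewrite /conj_stage -!mulmxA (mulmxA M0) mulmxV // mul1mx.
    by rewrite (mulmxA (stage _ _) (stage _ _)) (stageM flagx).
  rewrite -[in RHS]mulmxA -YS /conj_stage stageE !mulmxA mulmxV //.
  by rewrite mul1mx.
have [|M_den M_flag] := adapted_frame bk flagx _ PM.
  by rewrite unitmx_mul M0unit unipotent_unit.
have gu : (rden flag_chart).@[u] != 0.
  by rewrite /= (map_frame_den b (meval _)) map_chart_mx.
by split=> //; rewrite reval_frame_map // map_chart_mx M_flag mats_ofK.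
Qed.

(** For S = 1 + L the columns of S up to block i span the image of the i-th
    stage Y, as do those of the oblique projection T, so T fixes the columns of
    S in block i; but S has the same rows as the identity in these columns on
    the blocks up to i, so they are the columns of T. *)
Lemma flag_coords_chart u : (rden flag_chart).@[u] != 0 ->
  (rden flag_coords).@[reval flag_chart u] != 0 ->
  reval flag_coords (reval flag_chart u) = u.
Proof.
move=> gu; rewrite reval_frame_map // map_chart_mx.
have Mden : frame_den b (M0 *m (1%:M + lower_mx u)) != 0.
  by move: gu; rewrite /= (map_frame_den b (meval _)) map_chart_mx.
set S := 1%:M + lower_mx u; set P := frame_flag _ _; set x := coords P => hx.
have flagP : is_flag k P by apply: frame_flagP.
have xP : mats_of x = P by apply: coordsK => i; apply: flag_sym flagP i.
have flagx : is_flag k (mats_of x) by rewrite xP.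
apply/funext => t; rewrite -(enum_valK t); move: (enum_val t) => s.
rewrite reval_flag_coords // -(lower_mx_pos u s).
case: s => -[a c] /= ca; have lt_r : (b c < r)%N by apply: leq_trans ca (leq_ord _).
pose i := Ordinal lt_r; set Y := conj_stage x _; set T := oblique _ _.
have Hu := oblique_gram_unit (b c) hx.
have pp := blockproj_idem K b (b c).
have YE : Y = invmx M0 *m P i *m M0 by rewrite /Y /conj_stage (stageE _ i) xP.
have YS : Y *m S *m p (b c) = S *m p (b c).
  have PMp := frame_flag_image i Mden; rewrite -/S -/P -!mulmxA in PMp.
  rewrite YE -!mulmxA; have -> : p (b c) = p i by [].
  by rewrite PMp mulmxA mulVmx // mul1mx.
have TY : T *m Y = Y.
  apply: idempotent_absorb.
  - exact: oblique_idem.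
  - exact: conj_stage_idem flagx.
  - exact/oblique_image/(conj_stage_idem _ flagx).
  have trT : \tr T = (k i)%:R.
    by rewrite -(bk i) -(mxtrace_blockproj K b i); apply: oblique_trace.
  by rewrite trT YE mxtrace_mulC mulmxA mulmxV // mul1mx (flag_trace flagP).
have TS : T *m (p (b c) *m S) *m p (b c) = S *m p (b c).
  rewrite mulmxA oblique_projr // -mulmxA -{1}YS; move: YS; clearbody Y.
  by rewrite !mulmxA TY.
have := congr1 (fun N : 'M[K]_n => N a c) TS; rewrite !mul_blockproj leqnn => E.
have -> : lower_mx u a c = S a c.
  rewrite [RHS]mxE [X in X + _]mxE (_ : a == c = false) ?add0r //.
  by apply/eqP => ac; rewrite ac ltnn in ca.
rewrite -E [RHS]mxE (bigD1 c) //= big1 => [|e ec].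
  by rewrite blockproj_mul leqnn [S c c]mxE lower_mx0 // [1%:M _ _]mxE eqxx !addr0 mulr1.
rewrite blockproj_mul; case: ifP => [le_ec|]; last by rewrite mulr0.
by rewrite [S e c]mxE lower_mx0 // [1%:M _ _]mxE (negPf ec) addr0 mulr0.
Qed.

Lemma smooth_at_frame x : pFl K n k x ->
  (forall i : 'I_r, mats_of x i *m M0 = M0 *m p i) -> smooth_at (pFl K n k) x.
Proof.
move=> Xx PM; have /pFlP flagx := Xx.
have low0 : lower_mx (fun _ : 'I_d => 0 : K) = 0.
  by apply/matrixP => a c; rewrite !mxE; case: insub.
have [|M_den M_flag] := adapted_frame bk flagx M0unit.
  by move=> i; rewrite PM -mulmxA blockproj_idem.
have map0 : map_mx (meval (fun=> 0)) chart_mx = M0.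
  by rewrite map_chart_mx low0 addr0 mulmx1.
have g0 : (rden flag_chart).@[fun=> 0] != 0 by rewrite /= (map_frame_den b (meval _)) map0.
apply: (@smooth_at_chart K d _ _ flag_chart flag_coords (fun=> 0)) => //.
- exact: pFl_closed.
- by move=> u; apply: frame_map_pFl.
- by rewrite reval_frame_map // map0 M_flag mats_ofK.
- rewrite rden_flag_coords; apply/prodf_neq0 => i _.
  have -> : conj_stage x i = p i.
    by rewrite /conj_stage stageE -mulmxA PM mulmxA mulVmx // mul1mx.
  by rewrite /oblique_gram !blockproj_idem addrC subrK det1 oner_neq0.
- exact: flag_chart_coords.
- exact: flag_coords_chart.
Qed.

End FlagChart.

Theorem theorem2p7 (R : realType) (r n : nat) (k : 'I_r -> nat)
    (r_gt0 : (0 < r)%N)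
    (k_ge1 : forall i : 'I_r, (1 <= k i)%N)
    (k_incr : forall i j : 'I_r, (i < j)%N -> (k i < k j)%N)
    (k_le_n : forall i : 'I_r, (k i <= n)%N) :
  [/\ smooth (pFl R[i]%C n k),
      vanishing_ideal (pFl R[i]%C n k) = pFl_ideal R[i]%C n k &
      prime_ideal (pFl_ideal R[i]%C n k)].
Proof.
split; [|exact: vanishing_ideal_pFl | exact: pFl_ideal_prime].
have [b bk] := standard_blocks k_incr k_le_n => x Xx.
have /pFlP flagx := Xx; have [M Mu PM] := adapted_frame_exists bk flagx.
apply: (smooth_at_frame bk Mu Xx PM).
Qed.
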